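(* Let $x=(u,v)$ with $$x\in C([0,T];D(\mathcal L)\cap H^{k+1}(\mathcal T_h)^{m_u+m_v})\cap C^3([0,T];L^2(\Omega)^{m_u+m_v})$$ be the solution of the two-field Friedrichs' system $$\partial_t u=\mathcal L_v v+g_u,\qquad \partial_t v=\mathcal L_u u+g_v,\qquad u(0)=u^0,\quad v(0)=v^0 ,$$ and assume $g_v\in C^2([0,T];L^2(\Omega)^{m_v})$. Let $\vartheta_c\in(0,1)$ and let the time stepsize satisfy $0<\tau\le\min\{\tau_{\mathrm{CFL,lf},c}(\vartheta_c),\tau_{\mathrm{CFL},\Psi}\}$. Let $x_h^n=(u_h^n,v_h^n)\in\mathbb V_h$ be the approximations of the local time-integration scheme $$\begin{aligned} \overline v_h^{\,n+1/2}-v_h^n&=\tfrac{\tau}{2}\mathcal L_{u,h}u_h^n+\tfrac{\tau}{2}g_{v,h}^{n+1/2},\\ u_h^{n+1}-u_h^n&=\tau\mathbf\Psi\bigl(\mathcal L_{v,h}\overline v_h^{\,n+1/2}+g_{u,h}^{n+1/2}\bigr),\\ v_h^{n+1}-\overline v_h^{\,n+1/2}&=\tfrac{\tau}{2}\mathcal L_{u,h}u_h^{n+1}+\tfrac{\tau}{2}g_{v,h}^{n+1/2}, \end{aligned}$$ with initial value $x_h^0=\pi_h x(0)$. Then, for all $n\ge0$ with $t^{n+1}=(n+1)\tau\le T$, $$\|x(t^{n+1})-x_h^{n+1}\|_\Omega\le C(\tau^2+h_{\max}^k)$$ with a constant $C$ independent of $\tau$ and $h$.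
   Context: **Continuous problem.** $\Omega\subset\mathbb R^d$ is an open polygonal domain. $\mathcal M_u\in L^\infty(\Omega)^{m_u\times m_u}$, $\mathcal M_v\in L^\infty(\Omega)^{m_v\times m_v}$ are symmetric and (uniformly) positive definite. For $K\subseteq\Omega$ open, $(u,\tilde u)_K=\int_K \mathcal M_u u\cdot\tilde u\,dx$ and $(v,\tilde v)_K=\int_K\mathcal M_v v\cdot\tilde v\,dx$ for functions with $m_u$ resp. $m_v$ components; for pairs $x=(u,v)$ the two inner products are added. $\|\cdot\|_K$ denotes the induced norm. With matrices $L_i\in\mathbb R^{m_v\times m_u}$, the Friedrichs' operators are given by $\mathcal M_v\mathcal L_u u=\sum_{i=1}^d L_i\partial_i u$ and $\mathcal M_u\mathcal L_v v=\sum_{i=1}^d L_i^{\mathrm T}\partial_i v$ (weak derivatives) on domains $D(\mathcal L_u)\subset L^2(\Omega)^{m_u}$, $D(\mathcal L_v)\subset L^2(\Omega)^{m_v}$, which encode boundary conditions such that $(\mathcal L_u u,v)_\Omega=-(u,\mathcal L_v v)_\Omega$ for all $u\in D(\mathcal L_u)$, $v\in D(\mathcal L_v)$. Set $D(\mathcal L)=D(\mathcal L_u)\times D(\mathcal L_v)$. $u^0,v^0$ are initial values and $g=(g_u,g_v)$ is a right-hand side. **Discrete spaces.** $\mathcal T_h$ is an (admissible) mesh of $\Omega$, $h_K$ is the diameter of $K\in\mathcal T_h$, $h\in L^\infty(\Omega)$ with $h|_K=h_K$, $h_{\max}=\max_K h_K$. $\mathbb V_h^u$ and $\mathbb V_h^v$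 are the spaces of functions with $m_u$ resp. $m_v$ components that are on each $K\in\mathcal T_h$ polynomials of total degree at most $k$; $\mathbb V_h=\mathbb V_h^u\times\mathbb V_h^v$. $\pi_h$ is the orthogonal projection onto $\mathbb V_h$ (resp. $\mathbb V_h^u,\mathbb V_h^v$) with respect to $(\cdot,\cdot)_\Omega$. $H^\ell(\mathcal T_h)$ is the broken Sobolev space of $L^2(\Omega)$ functions whose restriction to each $K\in\mathcal T_h$ is in $H^\ell(K)$, with $|w|_{j,\mathcal T_h}^2=\sum_{K}\sum_{|\alpha|=j}\|\partial^\alpha w\|_K^2$ and $\|w\|_{\ell,\mathcal T_h}^2=\sum_{j=0}^\ell|w|_{j,\mathcal T_h}^2$. **Discrete operators.** $\mathcal L_{u,h}$, $\mathcal L_{v,h}$ are the central-fluxes discontinuous Galerkin discretizations of $\mathcal L_u,\mathcal L_v$. They are linear, defined on $\mathbb V_h^w+(D(\mathcal L_w)\cap H^1(\mathcal T_h)^{m_w})$ for $w\in\{u,v\}$, map into $\mathbb V_h^v$ and $\mathbb V_h^u$, respectively, and have the following known properties: - adjointness: $(\mathcal L_{u,h}u_h,v_h)_\Omega=-(u_h,\mathcal L_{v,h}v_h)_\Omega$ for all $u_h\in\mathbb V_h^u$, $v_h\in\mathbb V_h^v$; - consistency: $\mathcal L_{w,h}w=\pi_h\mathcal L_w w$ for $w\in D(\mathcal L_w)\cap H^1(\mathcal T_h)^{m_w}$; - approximation: $\|\mathcal L_{w,h}(w-\pi_h w)\|_\Omega\le C_{\pi,\mathcal L}|h^k w|_{k+1,\mathcal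 T_h}$ for $w\in D(\mathcal L_w)\cap H^{k+1}(\mathcal T_h)^{m_w}$. Moreover $\|w-\pi_hw\|_\Omega\le C_\pi|h^{k+1}w|_{k+1,\mathcal T_h}$ for $w\in H^{k+1}(\mathcal T_h)^{m_w}$. The constants $C_{\pi,\mathcal L},C_\pi$ are independent of $h$. **Mesh splitting.** $\mathcal T_h=\mathcal T_{h,f}\,\dot\cup\,\mathcal T_{h,c}$ is a disjoint splitting into fine and coarse elements. $\mathcal T_{h,m}$ consists of all elements of $\mathcal T_{h,f}$ and all elements sharing a face with an element of $\mathcal T_{h,f}$, and $\mathcal T_{h,\mathrm{lf}}=\mathcal T_h\setminus\mathcal T_{h,m}$. $\chi_m$ and $\chi_{\mathrm{lf}}$ denote multiplication by the indicator function of the union of the elements in $\mathcal T_{h,m}$ and $\mathcal T_{h,\mathrm{lf}}$, respectively. **Filter function.** $\Psi:[0,\infty)\to\mathbb R$ is smooth with $\Psi(0)=1$; $\mathbf\Psi=\Psi(-\tau^2\mathcal L_{v,h}\chi_m\mathcal L_{u,h})$ (functional calculus for a self-adjoint positive semidefinite operator on $\mathbb V_h^u$). Set $\Theta(z)=\frac1{\Psi(z)}-\frac z4$ (where $\Psi(z)\neq0$) and $\varphi(z)=\frac{\Theta(z)-1}{z}$ for $z>0$, $\varphi(0)=\Theta'(0)$. For a constant $c_\Theta\in(0,1]$, $\beta_\Psi\in(0,\infty]$ is the maximum value such that $0<\Psi(z)\le1$ and $\Theta(z)\ge c_\Theta$ for all real $z\in[0,\beta_\Psi^2]$ ($\beta_\Psi=\infty$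 if this holds for all $z\ge0$). $C_\varphi<\infty$ is the smallest constant with $|\varphi(z)|\le C_\varphi$ for all real $z\in[0,\beta_\Psi^2]$. **CFL bounds.** With operator norms induced by $\|\cdot\|_\Omega$ on $\mathbb V_h^u$, $$\tau_{\mathrm{CFL},\Psi}^2=\frac{\beta_\Psi^2}{\|\mathcal L_{v,h}\chi_m\mathcal L_{u,h}\|},\qquad \tau_{\mathrm{CFL,lf},c}^2(\vartheta_c)=\frac{4c_\Theta\vartheta_c^2}{\|\mathcal L_{v,h}\chi_{\mathrm{lf}}\mathcal L_{u,h}\|}$$ (understood as no restriction when $\beta_\Psi=\infty$ or the denominator vanishes). **Right-hand sides.** $t^n=n\tau$, $g_h^n=\pi_h g(t^n)$ and $g_h^{n+1/2}=(g_{u,h}^{n+1/2},g_{v,h}^{n+1/2})=\frac12(g_h^{n+1}+g_h^n)$. The constant $C$ may depend on $T$, $k$, $\Omega$, $c_\Theta$, $\vartheta_c$, $C_\varphi$, $C_\pi$, $C_{\pi,\mathcal L}$ and on the norms of $x$ and $g_v$ in the spaces indicated in the claim. *)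

(* Defs.v *)
From HB Require Import structures.
From mathcomp Require Import all_boot all_order all_algebra.
From mathcomp Require Import all_classical all_reals all_analysis.

Set Implicit Arguments.
Unset Strict Implicit.
Unset Printing Implicit Defensive.

Import Order.TTheory GRing.Theory Num.Theory.
Import numFieldNormedType.Exports.

Local Open Scope classical_set_scope.
Local Open Scope ring_scope.

Section LebesgueRd.
Context (R : realType).

Definition rV_to_tuple (d : nat) (x : 'rV[R]_d) : d.-tuple (measurableTypeR R) :=
  [tuple x ord0 i | i < d].

Definition tuple_to_rV (d : nat) (t : d.-tuple (measurableTypeR R)) : 'rV[R]_d :=
  \row_i tnth t i.

Definition tuple_cons (d : nat)
    (p : measurableTypeR R * d.-tuple (measurableTypeR R)) :
    d.+1.-tuple (measurableTypeR R) := [the d.+1.-tuple _ of p.1 :: p.2].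

Lemma measurable_tuple_cons d : measurable_fun setT (@tuple_cons d).
Proof. by apply: measurable_cons; [exact: measurable_fst|exact: measurable_snd]. Qed.

End LebesgueRd.

(* The product sigma-algebra, i.e. the one generated by the coordinates. *)
Section MeasurableRd.
Context (R : realType) (d : nat).

Definition rV_measurable : set (set 'rV[R]_d) :=
  preimage_set_system setT (@rV_to_tuple R d) measurable.

Let rV_sigma : sigma_algebra setT rV_measurable.
Proof. by apply: sigma_algebra_preimage; exact: sigma_algebra_measurable. Qed.

Let rV_measurable0 : rV_measurable set0.
Proof. by case: rV_sigma. Qed.

Let rV_measurableC A : rV_measurable A -> rV_measurable (~` A).
Proof. by case: rV_sigma => _ + _ mA => /(_ _ mA); rewrite setTD. Qed.

Let rV_measurable_bigcup (F : (set 'rV[R]_d)^nat) :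
  (forall i, rV_measurable (F i)) -> rV_measurable (\bigcup_i F i).
Proof. by case: rV_sigma => _ _; exact. Qed.

Definition rV_display : measure_display.
Proof. exact: (measure_tuple_display default_measure_display). Qed.

HB.instance Definition _ := @isMeasurable.Build rV_display 'rV[R]_d
  rV_measurable rV_measurable0 rV_measurableC rV_measurable_bigcup.

Lemma measurable_tuple_to_rV : measurable_fun setT (@tuple_to_rV R d).
Proof.
move=> _ A [B mB <-]; rewrite !setTI -comp_preimage.
rewrite (_ : _ \o _ = id) ?preimage_id//.
by apply/funext => t; apply: eq_from_tnth => i /=; rewrite tnth_mktuple mxE.
Qed.

End MeasurableRd.

Section Lebesgue.
Context (R : realType).

Definition push_measure d1 d2 (T1 : measurableType d1) (T2 : measurableType d2)
    (mu : {measure set T1 -> \bar R}) (f : T1 -> T2)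
    (mf : measurable_fun [set: T1] f) : {measure set T2 -> \bar R} :=
  measure_function_pushforward__canonical__measure_function_Measure mu mf.

Fixpoint lebesgue_tuple (d : nat) :
    {measure set (d.-tuple (measurableTypeR R)) -> \bar R} :=
  match d with
  | 0 => \d_ [tuple]
  | d'.+1 => push_measure (@lebesgue_measure R \x^ lebesgue_tuple d')%E
               (@measurable_tuple_cons R d')
  end.

Definition leb (d : nat) : {measure set 'rV[R]_d -> \bar R} :=
  push_measure (lebesgue_tuple d) (@measurable_tuple_to_rV R d).

End Lebesgue.

Section Geometry.
Context (R : realType) (d : nat).
Local Notation E := 'rV[R]_d.
Implicit Types (x y a : E).

Definition dotr x y : R := \sum_i x ord0 i * y ord0 i.

(* The norm of the library on 'rV[R]_d is the maximum norm. *)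
Definition enorm x : R := Num.sqrt (dotr x x).

Definition hyperplane a (b : R) : set E := [set x | dotr a x = b].

(* K = (closure K)° says that K lies on only one side of its boundary. *)
Definition polyhedral (K : set E) : Prop :=
  [/\ K !=set0, open K, connected K, bounded_set K &
      K = interior (closure K) /\
      exists (n : nat) (a : 'I_n -> E) (b : 'I_n -> R),
        (forall i, a i != 0) /\
        closure K `\` K `<=` \bigcup_(i in [set: 'I_n]) hyperplane (a i) (b i)].

Definition diameter (K : set E) : R :=
  sup [set r | exists x y, [/\ K x, K y & r = enorm (x - y)]].

(* The common boundary contains a relatively open piece of a hyperplane. *)
Definition share_face (K K' : set E) : Prop :=
  exists (a : E) (b : R) (x : E) (r : R),
    [/\ a != 0, 0 < r, hyperplane a b x &
        forall y, hyperplane a b y -> enorm (y - x) < r ->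
          (closure K `&` closure K') y].

Definition is_mesh (Om : set E) (N : nat) (Th : 'I_N -> set E) : Prop :=
  [/\ forall K, polyhedral (Th K),
      forall K K', K != K' -> Th K `&` Th K' = set0 &
      closure Om = \bigcup_(K in [set: 'I_N]) closure (Th K)].

Definition mesh_size (N : nat) (Th : 'I_N -> set E) : R :=
  \big[Num.max/0]_(K < N) diameter (Th K).

(* T_{h,m}: the fine elements and all elements sharing a face with one. *)
Definition mesh_m (N : nat) (Th : 'I_N -> set E) (fine : {set 'I_N}) :
    {set 'I_N} :=
  fine :|: [set K | [exists K' in fine,
                       (K != K') && `[< share_face (Th K) (Th K') >]]].

Definition mesh_lf (N : nat) (Th : 'I_N -> set E) (fine : {set 'I_N}) :
    {set 'I_N} := ~: mesh_m Th fine.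

Definition chi (N : nat) (Th : 'I_N -> set E) (S : {set 'I_N}) (m : nat)
    (w : E -> 'cV[R]_m) : E -> 'cV[R]_m :=
  fun x => \1_(\bigcup_(K in [set` S]) Th K) x *: w x.

End Geometry.

(* L^2 functions are represented by functions 'rV[R]_d -> 'cV[R]_m, only
   their values in the domain matter, and equality in L^2 is [aeq]. *)

Section Spaces.
Context (R : realType) (d : nat).
Local Notation E := 'rV[R]_d.
Local Notation mu := (leb R d).

Definition aeq (Om : set E) (T : Type) (f g : E -> T) : Prop :=
  f = g %[ae mu in Om].

Definition dotc (m : nat) (a b : 'cV[R]_m) : R := \sum_i a i ord0 * b i ord0.

Definition L2 (Om : set E) (m : nat) : set (E -> 'cV[R]_m) :=
  [set w : E -> 'cV[R]_m | forall i, measurable_fun Om (fun x => w x i ord0) /\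
     mu.-integrable Om (fun x => ((w x i ord0) ^+ 2)%:E)].

Definition is_weight (Om : set E) (m : nat) (M : E -> 'M[R]_m) : Prop :=
  [/\ forall i j, measurable_fun Om (fun x => M x i j),
      exists C : R, {ae mu, forall x, Om x -> forall i j, `|M x i j| <= C},
      {ae mu, forall x, Om x -> (M x)^T = M x} &
      exists2 c : R, 0 < c &
        {ae mu, forall x, Om x ->
           forall xi : 'cV[R]_m, c * dotc xi xi <= dotc (M x *m xi) xi}].

Definition ip (m : nat) (M : E -> 'M[R]_m) (K : set E) (w z : E -> 'cV[R]_m) : R :=
  \int[mu]_(x in K) dotc (M x *m w x) (z x).

Definition nrm (m : nat) (M : E -> 'M[R]_m) (K : set E) (w : E -> 'cV[R]_m) : R :=
  Num.sqrt (ip M K w w).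

Definition partial (i : 'I_d) (f : E -> R) : E -> R := fun x => 'D_('e_i) f x.

Definition smooth (f : E -> R) : Prop :=
  forall s : seq 'I_d, continuous (foldr partial f s) /\
    forall x (i : 'I_d), derivable (foldr partial f s) x 'e_i.

Definition test_function (K : set E) (f : E -> R) : Prop :=
  smooth f /\
  exists2 C, compact C /\ C `<=` K & forall x, ~ C x -> f x = 0.

Definition partial_multi (al : 'I_d -> nat) (f : E -> R) : E -> R :=
  foldr (fun i g => iter (al i) (partial i) g) f (enum 'I_d).

Definition is_weak_derivative (K : set E) (al : 'I_d -> nat) (m : nat)
    (w g : E -> 'cV[R]_m) : Prop :=
  forall f, test_function K f -> forall j : 'I_m,
    \int[mu]_(x in K) (w x j ord0 * partial_multi al f x) =
    (-1) ^+ (\sum_i al i)%N * \int[mu]_(x in K) (g x j ord0 * f x).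

(* The weak derivative of w on K, a representative being chosen; 0 if there
   is none in L^2. *)
Definition weak_derivative (K : set E) (al : 'I_d -> nat) (m : nat)
    (w : E -> 'cV[R]_m) : E -> 'cV[R]_m :=
  xget 0 [set g | L2 K g /\ is_weak_derivative K al w g].

Definition nrm2 (m_u m_v : nat) (Mu : E -> 'M[R]_m_u) (Mv : E -> 'M[R]_m_v)
    (K : set E) (u : E -> 'cV[R]_m_u) (v : E -> 'cV[R]_m_v) : R :=
  Num.sqrt (nrm Mu K u ^+ 2 + nrm Mv K v ^+ 2).

Section Broken.
Context (Om : set E) (N : nat) (Th : 'I_N -> set E).

Definition broken_sobolev (l m : nat) : set (E -> 'cV[R]_m) :=
  [set w : E -> 'cV[R]_m | L2 Om w /\
     forall (K : 'I_N) (al : 'I_d -> nat), (\sum_i al i <= l)%N ->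
       exists g, L2 (Th K) g /\ is_weak_derivative (Th K) al w g].

(* The seminorm |h^s w|_{j,T_h}; since h is the constant diam(K) on each element K, the
   weak derivatives of h^s w on K are those of w, multiplied by diam(K)^s. *)
Definition broken_seminorm (m : nat) (M : E -> 'M[R]_m) (s j : nat)
    (w : E -> 'cV[R]_m) : R :=
  Num.sqrt (\sum_(K < N) \sum_(al : {ffun 'I_d -> 'I_j.+1}
                               | (\sum_i al i == j :> nat)%N)
    nrm M (Th K)
      (diameter (Th K) ^+ s *: weak_derivative (Th K) (fun i => al i : nat) w)
      ^+ 2).

Definition broken_norm (m : nat) (M : E -> 'M[R]_m) (l : nat)
    (w : E -> 'cV[R]_m) : R :=
  Num.sqrt (\sum_(j < l.+1) broken_seminorm M 0 j w ^+ 2).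

(* The norm of D(L) \cap H^l(T_h), D(L) having the graph norm. *)
Definition graph_norm (mi mo : nat) (Mi : E -> 'M[R]_mi) (Mo : E -> 'M[R]_mo)
    (L : (E -> 'cV[R]_mi) -> E -> 'cV[R]_mo) (l : nat) (w : E -> 'cV[R]_mi) : R :=
  Num.sqrt (nrm Mi Om w ^+ 2 + nrm Mo Om (L w) ^+ 2 + broken_norm Mi l w ^+ 2).

Definition Vh (k m : nat) : set (E -> 'cV[R]_m) :=
  [set w : E -> 'cV[R]_m | L2 Om w /\
     forall (K : 'I_N) (j : 'I_m), exists c : {ffun 'I_d -> 'I_k.+1} -> R,
       aeq (Th K) (fun x => w x j ord0)
         (fun x => \sum_(al : {ffun 'I_d -> 'I_k.+1} | (\sum_i al i <= k)%N)
                     c al * \prod_i x ord0 i ^+ al i)].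

End Broken.

(* Friedrichs' operator [L] with (linear) domain [D]:
   Mo L w = \sum_i A_i \partial_i w in the weak sense. *)
Definition friedrichs_operator (Om : set E) (mi mo : nat)
    (Mo : E -> 'M[R]_mo) (A : 'I_d -> 'M[R]_(mo, mi))
    (D : set (E -> 'cV[R]_mi)) (L : (E -> 'cV[R]_mi) -> E -> 'cV[R]_mo) : Prop :=
  [/\ D `<=` L2 Om (m := mi),
      D 0 /\ (forall (c : R) w z, D w -> D z -> D (c *: w + z)),
      forall w z, D w -> L2 Om z -> aeq Om w z -> D z &
      forall w, D w -> L2 Om (L w) /\
        forall f, test_function Om f -> forall j : 'I_mo,
          \int[mu]_(x in Om) ((Mo x *m L w x) j ord0 * f x) =
          - \int[mu]_(x in Om)
              \sum_(i < d) (A i *m w x) j ord0 * partial i f x].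

Definition orthogonal_projection (Om : set E) (m : nat) (M : E -> 'M[R]_m)
    (V : set (E -> 'cV[R]_m)) (P : (E -> 'cV[R]_m) -> E -> 'cV[R]_m) : Prop :=
  forall w, L2 Om w -> V (P w) /\ forall z, V z -> ip M Om (w - P w) z = 0.

(* The discretization [Lh] of the operator [L] with domain [D]: linear on
   V_h + (D \cap H^1(T_h)) with values in the discrete space, consistent and
   with the approximation property. [Pi] and [Po] are the projections onto the
   discrete spaces of the arguments and of the values. *)
Definition dg_operator (Om : set E) (N : nat) (Th : 'I_N -> set E) (k : nat)
    (mi mo : nat) (Mi : E -> 'M[R]_mi) (Mo : E -> 'M[R]_mo)
    (D : set (E -> 'cV[R]_mi)) (L : (E -> 'cV[R]_mi) -> E -> 'cV[R]_mo)
    (Pi : (E -> 'cV[R]_mi) -> E -> 'cV[R]_mi)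
    (Po : (E -> 'cV[R]_mo) -> E -> 'cV[R]_mo)
    (C : R) (Lh : (E -> 'cV[R]_mi) -> E -> 'cV[R]_mo) : Prop :=
  let dom := [set w | exists a b, [/\ Vh Om Th k a, D b,
                        broken_sobolev Om Th 1 b & w = a + b]] in
  [/\ forall w, dom w -> Vh Om Th k (Lh w),
      forall (c : R) w z, dom w -> dom z ->
        aeq Om (Lh (c *: w + z)) (c *: Lh w + Lh z),
      forall w, D w -> broken_sobolev Om Th 1 w ->
        aeq Om (Lh w) (Po (L w)) &
      forall w, D w -> broken_sobolev Om Th k.+1 w ->
        nrm Mo Om (Lh (w - Pi w)) <= C * broken_seminorm Th Mi k k.+1 w].

(* [FA] is f(A) on the finite-dimensional space [V], for an operator [A] that is
   self-adjoint with respect to [ip M Om]: A has an orthonormal basis of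
   eigenvectors of V, and f is applied to the eigenvalues. *)
Definition functional_calculus (Om : set E) (m : nat) (M : E -> 'M[R]_m)
    (V : set (E -> 'cV[R]_m)) (f : R -> R)
    (A FA : (E -> 'cV[R]_m) -> E -> 'cV[R]_m) : Prop :=
  exists (n : nat) (e : 'I_n -> E -> 'cV[R]_m) (lam : 'I_n -> R),
    [/\ forall i, V (e i),
        forall i j, ip M Om (e i) (e j) = (i == j)%:R,
        forall i, aeq Om (A (e i)) (lam i *: e i),
        forall w, V w -> aeq Om w (\sum_i ip M Om w (e i) *: e i) &
        forall w, V w ->
          aeq Om (FA w) (\sum_i (f (lam i) * ip M Om w (e i)) *: e i)].

Definition operator_norm (Om : set E) (m : nat) (M : E -> 'M[R]_m)
    (V : set (E -> 'cV[R]_m)) (A : (E -> 'cV[R]_m) -> E -> 'cV[R]_m) : \bar R :=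
  ereal_sup [set (nrm M Om (A w))%:E | w in [set w | V w /\ nrm M Om w <= 1]].

End Spaces.

Section Time.
Context (R : realType) (V : lmodType R) (nm : V -> R) (I : set R).

Definition continuous_in (f : R -> V) : Prop :=
  forall t, I t -> forall e : R, 0 < e -> exists2 dl : R, 0 < dl &
    forall s, I s -> `|s - t| < dl -> nm (f s - f t) < e.

(* One-sided at the end points of the interval I. *)
Definition derivative_in (f f' : R -> V) : Prop :=
  forall t, I t -> forall e : R, 0 < e -> exists2 dl : R, 0 < dl &
    forall s, I s -> `|s - t| < dl ->
      nm (f s - f t - (s - t) *: f' t) <= e * `|s - t|.

(* f is n times continuously differentiable on I with values in the space X
   with norm nm, with derivatives df 0 = f, df 1, ..., df n. *)
Definition Cn_with (X : set V) (n : nat) (f : R -> V) (df : nat -> R -> V) : Prop :=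
  [/\ df 0%N = f,
      forall j t, (j <= n)%N -> I t -> X (df j t),
      forall j, (j < n)%N -> derivative_in (df j) (df j.+1) &
      continuous_in (df n)].

End Time.

Section Filter.
Context (R : realType) (Psi : R -> R).

Definition smooth_on_nonneg : Prop :=
  exists D : nat -> R -> R, (forall z, 0 <= z -> D 0%N z = Psi z) /\
    forall j, derivative_in (V := R^o) (fun z => `|z|) [set z | 0 <= z]
                (D j) (D j.+1).

Definition Theta (z : R) : R := (Psi z)^-1 - z / 4.

Definition phi (z : R) : R :=
  if z == 0 then lim ((Theta h - Theta 0) / h @[h --> 0^'+])
  else (Theta z - 1) / z.

Definition filter_bounds (cTheta : R) (b : \bar R) : Prop :=
  forall z : R, 0 <= z -> (z%:E <= b ^+ 2)%E ->
    0 < Psi z /\ Psi z <= 1 /\ cTheta <= Theta z.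

Definition is_beta (cTheta : R) (beta : \bar R) : Prop :=
  [/\ (0 < beta)%E, filter_bounds cTheta beta &
      forall b, (0 < b)%E -> filter_bounds cTheta b -> (b <= beta)%E].

Definition phi_bound (beta : \bar R) (C : R) : Prop :=
  forall z : R, 0 <= z -> (z%:E <= beta ^+ 2)%E -> `|phi z| <= C.

Definition is_Cphi (beta : \bar R) (C : R) : Prop :=
  phi_bound beta C /\ forall C', phi_bound beta C' -> C <= C'.

End Filter.

(* In \bar R, 0^-1 = +oo: these bounds are +oo, i.e. no restriction, if
   beta = +oo or if the operator norm [opn] vanishes. *)
Definition tau_CFL_Psi (R : realType) (beta opn : \bar R) : \bar R :=
  sqrte (beta ^+ 2 / opn)%E.

Definition tau_CFL_lf (R : realType) (cTheta theta : R) (opn : \bar R) : \bar R :=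
  sqrte ((4 * cTheta * theta ^+ 2)%:E / opn)%E.

(* Main.v *)
From HB Require Import structures.
Require Import Defs.
From mathcomp Require Import all_boot all_order all_algebra.
From mathcomp Require Import all_classical all_reals all_analysis.
From mathcomp Require Import measurable_realfun ring lra.

Set Implicit Arguments.
Unset Strict Implicit.
Unset Printing Implicit Defensive.

Import Order.TTheory GRing.Theory Num.Theory.
Import numFieldNormedType.Exports.

Local Open Scope classical_set_scope.
Local Open Scope ring_scope.

(** The error estimate rests on an energy argument for an equivalent one-step method.

    Let L and - L^* be the discrete operators, and let pi be the projections onto the discrete
    spaces. Eliminating the intermediate value of v, the scheme becomes the Crank-Nicolson
    method in which the difference of u is multiplied by
    G = Psi^-1 - tau^2/4 L^* L
    (scheme_u, scheme_v). On the part of L^* L that belongs to the elements in T_(h,m), this is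
    the function Theta of the local operator, and the remaining part is controlled by the second
    step size restriction. Hence G is bounded from below by cTheta (1 - theta^2), uniformly in
    the mesh (weight_form_coercive), and the Crank-Nicolson structure conserves the energy that
    consists of the form of G and the squared norm of v.

    The errors e_u and e_v of the numerical solution against pi u and pi v satisfy the same
    recursion with defects. Those caused by the trapezoidal rule and by the approximation
    properties of L are of size tau (tau^2 + h^k) (trapezoid_defect). The difficulty is the
    defect (G - I) (pi u(t') - pi u(t)), where t' = t + tau, because G - I is not bounded
    uniformly in the mesh and a plain estimate would also lose one order in tau. Both obstacles
    are removed by the factorization
    G - I = tau^2 L^* M L
    with a bounded operator M (weight_form_sub_id, coupling_le); the bound for M is that of
    phi = (Theta - 1)/z. Tested with an error, the defect becomes the product of
    s = tau M L (pi u(t') - pi u(t)) with tau L e_u, and the second equation of the recursion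
    expresses tau L e_u by differences of e_v. A summation by parts in time then moves these
    differences onto s (energy_step, energy_sum). As L pi u is v_t - g_v up to a consistency
    error, s is of size tau^2 + h^k, and its differences are of size tau (tau^2 + h^k)
    by the bounds for the third derivative of v and the second derivative of g_v
    (projected_first_difference, projected_second_difference). Comparing the maximal energy with
    these bounds yields the estimate (stability, convergence).

    The statement concerns functions rather than classes of functions, and the exact solution
    takes values in L2. Every identity is therefore used after testing, and the Taylor
    estimates are applied to scalar products with a fixed discrete function. The measure
    theory consists of the measurability of the elements, of the fact that the
    mesh exhausts the domain up to hyperplanes, which are null sets, and of the properties of
    the weighted inner product on L2. *)

(** * Semi-inner products *)

Section SemiInner.
Context (R : rcfType) (V : lmodType R).

Definition semi_inner (b : V -> V -> R) : Prop :=
  [/\ forall c x y z, b (c *: x + y) z = c * b x z + b y z,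
      forall x y, b x y = b y x & forall x, 0 <= b x x].

Definition snorm (b : V -> V -> R) (x : V) : R := Num.sqrt (b x x).

Context (b : V -> V -> R) (hb : semi_inner b).
Implicit Types (x y z : V) (c : R).
Local Notation nm := (snorm b).

Lemma siC x y : b x y = b y x. Proof. by case: hb. Qed.
Lemma si_ge0 x : 0 <= b x x. Proof. by case: hb. Qed.

Lemma siDl x y z : b (x + y) z = b x z + b y z.
Proof. by case: hb => h _ _; have := h 1 x y z; rewrite scale1r mul1r. Qed.

Lemma si0l z : b 0 z = 0.
Proof. by apply: (addrI (b 0 z)); rewrite -siDl !addr0. Qed.

Lemma siZl c x z : b (c *: x) z = c * b x z.
Proof. by case: hb => h _ _; have := h c x 0 z; rewrite addr0 si0l addr0. Qed.

Lemma siNl x z : b (- x) z = - b x z.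
Proof. by rewrite -scaleN1r siZl mulN1r. Qed.

Lemma siBl x y z : b (x - y) z = b x z - b y z.
Proof. by rewrite siDl siNl. Qed.

Lemma siDr z x y : b z (x + y) = b z x + b z y.
Proof. by rewrite !(siC z) siDl. Qed.
Lemma siZr c z x : b z (c *: x) = c * b z x.
Proof. by rewrite !(siC z) siZl. Qed.
Lemma siNr z x : b z (- x) = - b z x.
Proof. by rewrite !(siC z) siNl. Qed.
Lemma siBr z x y : b z (x - y) = b z x - b z y.
Proof. by rewrite siDr siNr. Qed.

Lemma si_suml n (F : 'I_n -> V) z : b (\sum_i F i) z = \sum_i b (F i) z.
Proof.
by apply: (big_morph (fun x => b x z)) => [x y|]; rewrite ?siDl ?si0l.
Qed.

Lemma snorm_ge0 x : 0 <= nm x. Proof. exact: sqrtr_ge0. Qed.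

Lemma snormE x : nm x ^+ 2 = b x x. Proof. by rewrite sqr_sqrtr ?si_ge0. Qed.

(** The quadratic polynomial t |-> b (x + t y) (x + t y) is nonnegative; the form
    may be degenerate, so that y may be a nonzero null vector. *)
Lemma cauchy_schwarz_sq x y : b x y ^+ 2 <= b x x * b y y.
Proof.
have key t : 0 <= b x x + 2 * t * b x y + t ^+ 2 * b y y.
  have := si_ge0 (x + t *: y).
  rewrite siDl !siDr !siZl !siZr (siC y x) => /le_trans; apply.
  by rewrite le_eqVlt; apply/orP; left; apply/eqP; ring.
have [y0|yn0] := eqVneq (b y y) 0.
  have [->|xy0] := eqVneq (b x y) 0; first by rewrite expr0n mulr_ge0 ?si_ge0.
  have := key (- (b x x + 1) / (2 * b x y)); rewrite y0 mulr0 addr0.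
  rewrite (_ : 2 * _ * _ = - (b x x + 1)); first by lra.
  by field.
have ypos : 0 < b y y by rewrite lt_def yn0 si_ge0.
have := key (- b x y / b y y).
rewrite (_ : _ + _ + _ = b x x - b x y ^+ 2 / b y y); last by field.
by rewrite subr_ge0 ler_pdivrMr.
Qed.

Lemma cauchy_schwarz x y : `|b x y| <= nm x * nm y.
Proof.
rewrite -sqrtrM ?si_ge0// -sqrtr_sqr ler_wsqrtr//; exact: cauchy_schwarz_sq.
Qed.

Lemma snormD x y : nm (x + y) <= nm x + nm y.
Proof.
rewrite -(@ler_pXn2r _ 2) ?nnegrE ?addr_ge0 ?snorm_ge0//.
rewrite snormE siDl !siDr sqrrD !snormE (siC y x).
have /ler_normlW := cauchy_schwarz x y; lra.
Qed.

Lemma snormZ c x : nm (c *: x) = `|c| * nm x.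
Proof.
by rewrite /snorm siZl siZr mulrA sqrtrM -?expr2 ?sqr_ge0// sqrtr_sqr.
Qed.

Lemma snormN x : nm (- x) = nm x.
Proof. by rewrite -scaleN1r snormZ normrN1 mul1r. Qed.

Lemma snormB x y : nm (x - y) <= nm x + nm y.
Proof. by rewrite -(snormN y) snormD. Qed.

(** A bounded functional that is represented by x bounds the norm of x: take
    z = x. This is how norms of discrete functions are estimated below, since these
    are known only through their products with test functions. *)
Lemma snorm_le_dual x c : 0 <= c -> (forall z, `|b x z| <= c * nm z) ->
  nm x <= c.
Proof.
move=> c0 h; have [->//|x0] := eqVneq (nm x) 0.
have xp : 0 < nm x by rewrite lt_def x0 snorm_ge0.
have := h x; rewrite -snormE ger0_norm ?sqr_ge0// expr2.
by rewrite ler_pM2r.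
Qed.

End SemiInner.

(** * Stability of the error recursion *)

(** The discrete spaces are U and V, the discrete operators L and L', and P is the cut-off to
    the elements in T_(h,m); L^* stands for - L'. All identities are only required
    after testing, because the inner products do not distinguish functions that agree
    almost everywhere. The eigenvectors e of the local operator have the
    eigenvalues lam (scaled by tau^2), and psi holds the values of the filter there. *)
Section Stability.
Context (R : rcfType) (U V : lmodType R).
Context (a : U -> U -> R) (b : V -> V -> R).
Context (ha : semi_inner a) (hb : semi_inner b).
Context (L : U -> V) (L' : V -> U) (P : V -> V).
Context (adj : forall w z, b (L w) z = - a w (L' z)).
Context (Psa : forall z z', b (P z) z' = b z (P z')).
Context (Pid : forall z z', b (P z) (P z') = b (P z) z').
Context (n : nat) (e : 'I_n -> U) (lam psi : 'I_n -> R) (tau cT th Cp : R).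
Context (eON : forall i j, a (e i) (e j) = (i == j)%:R).
Context (eE : forall w z, a w z = \sum_i a w (e i) * a z (e i)).
Context (tau0 : 0 < tau).
Context (eig : forall i w, tau ^+ 2 * b (P (L (e i))) (L w) = lam i * a (e i) w).
Context (psi0 : forall i, 0 < psi i).
Context (hcT : forall i, cT <= (psi i)^-1 - lam i / 4).
Context (hCp : forall i, `|(psi i)^-1 - lam i / 4 - 1| <= Cp * lam i).
Context (cT0 : 0 < cT) (cT1 : cT <= 1) (th01 : 0 < th < 1).
Context (cfl : forall w, tau ^+ 2 * (b (L w) (L w) - b (P (L w)) (L w))
                  <= 4 * cT * th ^+ 2 * a w w).
Local Notation nu := (snorm a).
Local Notation nv := (snorm b).

Lemma eigenvalue_ge0 i : 0 <= lam i.
Proof.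
have := eig i (e i); rewrite eON eqxx mulr1 => <-.
by rewrite mulr_ge0 ?sqr_ge0// -Pid si_ge0.
Qed.

Lemma bLDl w w' z : b (L (w + w')) z = b (L w) z + b (L w') z.
Proof. by rewrite !adj (siDl ha) opprD. Qed.

Lemma bLBl w w' z : b (L (w - w')) z = b (L w) z - b (L w') z.
Proof. by rewrite !adj (siBl ha) opprB opprK addrC. Qed.

Lemma bLE w z : b (L w) z = \sum_i a w (e i) * b (L (e i)) z.
Proof.
rewrite adj eE -sumrN; apply: eq_bigr => i _.
by rewrite adj (siC ha (L' z)) mulrN.
Qed.

Lemma local_form_diag w w' :
  tau ^+ 2 * b (P (L w)) (L w') = \sum_i lam i * (a w (e i) * a w' (e i)).
Proof.
rewrite Psa bLE mulr_sumr; apply: eq_bigr => i _.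
by rewrite -Psa mulrCA eig (siC ha w' (e i)) mulrCA.
Qed.

(** The form of Psi^-1 - tau^2/4 L^* L. Once the intermediate value of v is eliminated,
    the scheme is the Crank-Nicolson method in which this operator replaces the
    identity in front of the difference of u, so that this form and b give the conserved
    energy. *)
Definition weight_form (x y : U) : R :=
  \sum_i (psi i)^-1 * (a x (e i) * a y (e i)) - tau ^+ 2 / 4 * b (L x) (L y).

Lemma weight_formC x y : weight_form x y = weight_form y x.
Proof.
rewrite /weight_form (siC hb (L x)); congr (_ - _).
by apply: eq_bigr => i _; rewrite (mulrC (a x _)).
Qed.

Lemma weight_formDl x y z : weight_form (x + y) z = weight_form x z + weight_form y z.
Proof.
rewrite /weight_form bLDl; under eq_bigr do rewrite (siDl ha) mulrDl mulrDr.
by rewrite big_split/=; ring.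
Qed.

Lemma weight_formBl x y z : weight_form (x - y) z = weight_form x z - weight_form y z.
Proof. by have := weight_formDl (x - y) y z; rewrite subrK => ->; rewrite addrK. Qed.

(** The part of L^* L that is cut out by P is diagonal in the basis e and turns the
    filter Psi into Theta. *)
Lemma weight_formE x y : weight_form x y =
  \sum_i ((psi i)^-1 - lam i / 4) * (a x (e i) * a y (e i))
  - tau ^+ 2 / 4 * (b (L x) (L y) - b (P (L x)) (L y)).
Proof.
transitivity (\sum_i (psi i)^-1 * (a x (e i) * a y (e i))
  - 4^-1 * (\sum_i lam i * (a x (e i) * a y (e i)))
  - tau ^+ 2 / 4 * (b (L x) (L y) - b (P (L x)) (L y))).
  by rewrite -local_form_diag /weight_form; ring.
rewrite mulr_sumr -sumrB; congr (_ - _); apply: eq_bigr => i _; ring.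
Qed.

(** Theta is at least cT on the spectrum, and the step size restriction for the
    remaining part of L^* L takes away at most the fraction th^2 of this. *)
Lemma weight_form_coercive x : cT * (1 - th ^+ 2) * nu x ^+ 2 <= weight_form x x.
Proof.
rewrite weight_formE (snormE ha).
have h1 : cT * a x x <= \sum_i ((psi i)^-1 - lam i / 4) * (a x (e i) * a x (e i)).
  rewrite eE mulr_sumr; apply: ler_sum => i _; apply: ler_wpM2r => //.
  by rewrite -expr2 sqr_ge0.
have := cfl x; lra.
Qed.

Lemma snorm_compl_le z : nv (z - P z) <= nv z.
Proof.
rewrite -(@ler_pXn2r _ 2) ?nnegrE ?snorm_ge0//.
rewrite !(snormE hb) (siBl hb) !(siBr hb) Pid -(Psa z).
by have := si_ge0 hb (P z); rewrite Pid; lra.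
Qed.

(* The vectors q i are orthogonal, with squared norm lam i / tau^2. *)
Let q i := P (L (e i)).

Lemma bqq i j : tau ^+ 2 * b (q i) (q j) = lam i * (i == j)%:R.
Proof. by rewrite Pid eig eON. Qed.

Let t2 : tau ^+ 2 != 0. Proof. by rewrite expf_neq0// gt_eqF. Qed.

Lemma bqq1 i : b (q i) (q i) = lam i / tau ^+ 2.
Proof. by apply: (mulfI t2); rewrite bqq eqxx mulr1 mulrCA divff// mulr1. Qed.

Lemma bqq0 i j : j != i -> b (q j) (q i) = 0.
Proof.
by move=> ji; apply: (mulfI t2); rewrite bqq (negPf ji) !mulr0.
Qed.

Lemma bLq x i : tau ^+ 2 * b (L x) (q i) = lam i * a x (e i).
Proof. by rewrite (siC hb) eig (siC ha). Qed.

(** In terms of the normalized vectors q i, this is the diagonal operator with the entries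
    (Theta(lam i) - 1) / lam i. These are the values of the function phi, which are
    bounded although Theta - 1 need not be. Where lam i = 0, the convention 0^-1 = 0
    drops the term, as it should since q i is then null. *)
Definition coupling_fine (y : V) : V :=
  \sum_i (tau ^+ 2 * ((psi i)^-1 - lam i / 4 - 1) / lam i ^+ 2 * b y (q i)) *: q i.

(** The operator M with G - I = tau^2 L^* M L for the operator G of weight_form. It acts on V,
    where it is bounded uniformly in the mesh, whereas G - I is not. *)
Definition coupling (y : V) : V := coupling_fine y - 4^-1 *: (y - P y).

Lemma coupling_fineE y z : b (coupling_fine y) z =
  \sum_i tau ^+ 2 * ((psi i)^-1 - lam i / 4 - 1) / lam i ^+ 2 * b y (q i) * b (q i) z.
Proof.
rewrite (si_suml hb); apply: eq_bigr => i _; by rewrite (siZl hb).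
Qed.

Lemma couplingB y y' z :
  b (coupling y - coupling y') z = b (coupling (y - y')) z.
Proof.
rewrite /coupling !(siBl hb) !(siZl hb) !(siBl hb) !Psa !(siBl hb) !coupling_fineE.
under [X in _ = X - _]eq_bigr do rewrite (siBl hb) mulrBr mulrBl.
rewrite sumrB; ring.
Qed.

Lemma theta_sub1_null i : lam i = 0 -> (psi i)^-1 - lam i / 4 - 1 = 0.
Proof.
by move=> l0; apply/eqP; rewrite -normr_le0; have := hCp i; rewrite {2}l0 mulr0.
Qed.

(** Bessel's inequality for the normalized q_i. *)
Lemma bessel y : \sum_i tau ^+ 2 / lam i * b y (q i) ^+ 2 <= b y y.
Proof.
pose p : V := \sum_i (tau ^+ 2 / lam i * b y (q i)) *: q i.
have pz z : b p z = \sum_i tau ^+ 2 / lam i * b y (q i) * b (q i) z.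
  by rewrite (si_suml hb); apply: eq_bigr => i _; rewrite (siZl hb).
have py : b p y = \sum_i tau ^+ 2 / lam i * b y (q i) ^+ 2.
  by rewrite pz; apply: eq_bigr => i _; rewrite (siC hb (q i)) expr2 mulrA.
have pq i : lam i != 0 -> b p (q i) = b y (q i).
  move=> li; rewrite pz (bigD1 i)//= big1 ?addr0 => [|j ji].
    by rewrite bqq1; field; rewrite li gt_eqF.
  by rewrite bqq0// mulr0.
have pp : b p p = b p y.
  rewrite py {1}pz; apply: eq_bigr => i _.
  have [->|li] := eqVneq (lam i) 0; first by rewrite invr0 mulr0 !mul0r.
  by rewrite (siC hb (q i)) pq// expr2 mulrA.
have := si_ge0 hb (y - p); rewrite (siBl hb) !(siBr hb) (siC hb y p) pp -py; lra.
Qed.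

(** By orthogonality, the squared norm is the sum of the terms of Bessel's inequality, each
    with the factor phi(lam i)^2. *)
Lemma coupling_fine_le y : 0 <= Cp -> nv (coupling_fine y) <= Cp * nv y.
Proof.
move=> C0.
rewrite -(@ler_pXn2r _ 2) ?nnegrE ?mulr_ge0 ?snorm_ge0// exprMn !(snormE hb).
apply: (@le_trans _ _ (Cp ^+ 2 * \sum_i tau ^+ 2 / lam i * b y (q i) ^+ 2)); last first.
  by rewrite ler_wpM2l ?sqr_ge0 ?bessel.
rewrite coupling_fineE mulr_sumr; apply: ler_sum => i _.
rewrite (siC hb (q i)) coupling_fineE (bigD1 i)//= big1 ?addr0 => [|j ji]; last first.
  by rewrite bqq0// mulr0.
have [l0|li] := eqVneq (lam i) 0; first by rewrite theta_sub1_null// !(mulr0, mul0r) l0 invr0 !(mulr0, mul0r).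
have lp : 0 < lam i by rewrite lt_def li eigenvalue_ge0.
set w := _ - 1.
rewrite bqq1.
rewrite [leLHS](_ : _ = w ^+ 2 * (tau ^+ 2 / lam i ^+ 3 * b y (q i) ^+ 2)); last first.
  by field; rewrite li gt_eqF.
rewrite [leRHS](_ : _ = (Cp * lam i) ^+ 2 * (tau ^+ 2 / lam i ^+ 3 * b y (q i) ^+ 2)); last first.
  by field; rewrite li.
apply: ler_wpM2r.
  by rewrite mulr_ge0 ?sqr_ge0// divr_ge0 ?sqr_ge0// exprn_ge0// ltW.
rewrite -(real_normK (num_real w)) ler_pXn2r ?nnegrE ?mulr_ge0 ?(ltW lp)//.
exact: hCp.
Qed.

Lemma coupling_le y : 0 <= Cp -> nv (coupling y) <= (Cp + 1) * nv y.
Proof.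
move=> C0; apply: (le_trans (snormB hb _ _)).
rewrite (snormZ hb) ger0_norm ?invr_ge0//.
have := coupling_fine_le y C0; have := snorm_compl_le y; have := snorm_ge0 b y; lra.
Qed.

Lemma weight_form_sub_id x w :
  weight_form x w - a x w = tau ^+ 2 * b (coupling (L x)) (L w).
Proof.
rewrite weight_formE eE /coupling (siBl hb) (siZl hb) (siBl hb) coupling_fineE.
rewrite [RHS]mulrBr mulr_sumr addrAC -sumrB; congr (_ - _); last by ring.
apply: eq_bigr => i _.
have h z : b (L z) (q i) = lam i * a z (e i) / tau ^+ 2.
  by rewrite -bLq; field; rewrite gt_eqF.
rewrite (siC hb (q i)) !h.
have [l0|li] := eqVneq (lam i) 0; last by field; rewrite ?li ?gt_eqF//.
rewrite [LHS](_ : _ = ((psi i)^-1 - lam i / 4 - 1) * (a x (e i) * a w (e i))).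
  by rewrite theta_sub1_null// !(mulr0, mul0r).
by ring.
Qed.

(** The error recursion. The defects du and dv are bounded functionals. The defect s enters
    through L, which is unbounded in the mesh size: this is the part that comes from the
    difference of G and the identity. *)
Context (N : nat) (eu : nat -> U) (ev s : nat -> V).
Context (du : nat -> U -> R) (dv : nat -> V -> R) (c1 c2 c3 delta T : R).
Context (eu0 : forall w, a (eu 0%N) w = 0) (ev0 : forall z, b (ev 0%N) z = 0).
Context (recu : forall m w, (m <= N)%N ->
  weight_form (eu m.+1 - eu m) w =
    - (tau / 2) * b (L w) (ev m + ev m.+1) + du m w + tau * b (s m) (L w)).
Context (recv : forall m z, (m <= N)%N ->
  b (ev m.+1 - ev m) z = tau / 2 * b (L (eu m + eu m.+1)) z + dv m z).
Context (c10 : 0 <= c1) (c20 : 0 <= c2) (c30 : 0 <= c3) (d0 : 0 <= delta).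
Context (duB : forall m w, (m <= N)%N -> `|du m w| <= tau * c1 * delta * nu w).
Context (dvB : forall m z, (m <= N)%N -> `|dv m z| <= tau * c1 * delta * nv z).
Context (sB : forall m, (m <= N)%N -> nv (s m) <= c2 * delta).
Context (sdB : forall m, (m < N)%N -> nv (s m.+1 - s m) <= tau * c3 * delta).
Context (hT : N.+1%:R * tau <= T).

Let en m := weight_form (eu m) (eu m) + b (ev m) (ev m).

(** Test with the sums of consecutive errors; the coupling terms in L cancel by
    adjointness. In the term with s, the equation for ev is used to replace tau L applied
    to the sum of eu by twice the difference of ev, which removes the unbounded operator. *)
Lemma energy_step m : (m <= N)%N ->
  en m.+1 - en m = du m (eu m + eu m.+1) + dv m (ev m + ev m.+1)
     + 2 * b (ev m.+1 - ev m) (s m) - 2 * dv m (s m).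
Proof.
move=> mN; have h1 := recu (eu m + eu m.+1) mN.
have h2 := recv (ev m + ev m.+1) mN.
have h3 := recv (s m) mN.
have g : weight_form (eu m.+1 - eu m) (eu m + eu m.+1) =
    weight_form (eu m.+1) (eu m.+1) - weight_form (eu m) (eu m).
  by rewrite weight_formC weight_formDl !(weight_formC _ (_ - _)) !weight_formBl (weight_formC (eu m)); ring.
have g' : b (ev m.+1 - ev m) (ev m + ev m.+1) =
    b (ev m.+1) (ev m.+1) - b (ev m) (ev m).
  by rewrite (siBl hb) !(siDr hb) (siC hb (ev m)); ring.
rewrite /en; rewrite (siC hb (s m)) in h1; lra.
Qed.

Let K : R := \big[Num.max/0]_(m < N.+2) Num.max (nu (eu m)) (nv (ev m)).

Let K_ge0 : 0 <= K.
Proof. by apply: bigmax_ge_id. Qed.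

Let K_eu m : (m <= N.+1)%N -> nu (eu m) <= K.
Proof.
move=> mN; apply: le_trans (le_bigmax _ _ (Ordinal (mN : m < N.+2)%N)).
by rewrite le_max lexx.
Qed.

Let K_ev m : (m <= N.+1)%N -> nv (ev m) <= K.
Proof.
move=> mN; apply: le_trans (le_bigmax _ _ (Ordinal (mN : m < N.+2)%N)).
by rewrite le_max lexx orbT.
Qed.

Let inc := 4 * c1 * delta * K + 2 * c1 * c2 * delta ^+ 2 + 2 * c3 * delta * K.

Let weight_form_eu0 w : weight_form (eu 0) w = 0.
Proof.
rewrite /weight_form big1 => [|i _]; last by rewrite eu0 mul0r mulr0.
by rewrite adj eu0 oppr0 mulr0 subr0.
Qed.

Let dbound (f : R) (x : R) (y : R) : 0 <= y -> `|f| <= tau * c1 * delta * x ->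
  x <= y -> f <= tau * (c1 * delta * y).
Proof.
move=> y0 /ler_normlW h xy; apply: le_trans h _.
by rewrite -!mulrA !ler_wpM2l ?(ltW tau0).
Qed.

(** Summation by parts in the differences of ev: the first difference of s is smaller than s
    by a factor tau, which saves the second order in time. *)
Lemma energy_sum m : (m <= N)%N ->
  en m.+1 - 2 * b (s m) (ev m.+1) <= m.+1%:R * (tau * inc).
Proof.
have du1 j : (j <= N)%N -> du j (eu j + eu j.+1) <= tau * (c1 * delta * (2 * K)).
  move=> jN; apply: dbound (duB _ jN) _; first by have := K_ge0; lra.
  apply: (le_trans (snormD ha _ _)).
  have := K_eu (leqW jN); have := @K_eu j.+1 jN; lra.
have dv1 j : (j <= N)%N -> dv j (ev j + ev j.+1) <= tau * (c1 * delta * (2 * K)).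
  move=> jN; apply: dbound (dvB _ jN) _; first by have := K_ge0; lra.
  apply: (le_trans (snormD hb _ _)).
  have := K_ev (leqW jN); have := @K_ev j.+1 jN; lra.
have dv2 j : (j <= N)%N -> - dv j (s j) <= tau * (c1 * delta * (c2 * delta)).
  move=> jN; apply: (@dbound _ (nv (s j))); first by rewrite mulr_ge0.
    by rewrite normrN dvB.
  exact: sB.
elim: m => [|m IH] mN.
  have := energy_step mN; rewrite /en weight_form_eu0 ev0.
  rewrite (siBl hb) ev0 (siC hb (ev 1%N) (s 0%N)).
  have := du1 _ mN; have := dv1 _ mN; have := dv2 _ mN; rewrite /inc.
  have : 0 <= tau * (2 * c3 * delta * K) by rewrite !mulr_ge0// ltW.
  set A1 := du _ _; set A2 := dv _ _; set A3 := dv _ _; set A4 := weight_form _ _.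
  set A5 := b _ (ev 1%N); set A6 := b _ (ev 1%N).
  nra.
have := energy_step mN; have := IH (ltnW mN).
rewrite (siBl hb) (siC hb (ev m.+2)) (siC hb (ev m.+1) (s m.+1)).
have sd : - b (s m.+1 - s m) (ev m.+1) <= tau * (c3 * delta * K).
  apply: (le_trans (ler_norm _)); rewrite normrN; apply: (le_trans (cauchy_schwarz hb _ _)).
  rewrite !mulrA; apply: ler_pM; rewrite ?snorm_ge0 ?sdB ?K_ev//; exact: ltnW.
rewrite (siBl hb) in sd.
have := du1 _ mN; have := dv1 _ mN; have := dv2 _ mN.
rewrite -[in X in _ -> _ -> _ -> _ -> _ -> X]natr1 mulrDl mul1r.
have -> : tau * inc = tau * (c1 * delta * (2 * K)) * 2
   + 2 * (tau * (c1 * delta * (c2 * delta))) + 2 * (tau * (c3 * delta * K)).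
  by rewrite /inc; ring.
lra.
Qed.

(** With K the maximal error norm, the energy bound reads c K^2 <= al delta K + ga delta^2,
    where c is the coercivity constant of weight_form. This quadratic
    inequality bounds K by a multiple of delta. *)
Lemma stability : nu (eu N.+1) + nv (ev N.+1) <=
  2 * ((2 * c2 + 4 * T * c1 + 2 * T * c3 + 2 * T * c1 * c2) / (cT * (1 - th ^+ 2)) + 1) * delta.
Proof.
set al := 2 * c2 + 4 * T * c1 + 2 * T * c3; set ga := 2 * T * c1 * c2.
set c := cT * (1 - th ^+ 2).
have T0 : 0 <= T by apply: le_trans hT; rewrite mulr_ge0// ltW.
have al0 : 0 <= al by rewrite !addr_ge0 ?mulr_ge0.
have ga0 : 0 <= ga by rewrite !mulr_ge0.
have cp : 0 < c.
  rewrite mulr_gt0// subr_gt0 expr_lt1//; case/andP: th01 => // t0 _; exact: ltW.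
have en_le m : (m <= N)%N -> en m.+1 <= al * delta * K + ga * delta ^+ 2.
  move=> mN; have := energy_sum mN.
  have h : b (s m) (ev m.+1) <= c2 * delta * K.
    apply: (le_trans (ler_norm _)); apply: (le_trans (cauchy_schwarz hb _ _)).
    by apply: ler_pM; rewrite ?snorm_ge0 ?sB ?K_ev.
  have : m.+1%:R * (tau * inc) <= T * inc.
    rewrite mulrA ler_wpM2r//; first by rewrite /inc !addr_ge0 ?mulr_ge0 ?sqr_ge0.
    apply: le_trans hT; rewrite ler_wpM2r ?(ltW tau0)// ler_nat//.
  rewrite /al /ga /inc; lra.
have en_ge m : c * nu (eu m) ^+ 2 + nv (ev m) ^+ 2 <= en m.
  by rewrite (snormE hb) lerD2r weight_form_coercive.
have c1' : c <= cT.
  by rewrite /c ger_pMr// gerBl sqr_ge0.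
set X := al * delta * K + ga * delta ^+ 2.
have X0 : 0 <= X by rewrite /X addr_ge0 ?mulr_ge0 ?sqr_ge0.
have Xb m : (m <= N.+1)%N -> c * nu (eu m) ^+ 2 <= X /\ c * nv (ev m) ^+ 2 <= X.
  have [nu2 nv2] : 0 <= nu (eu m) ^+ 2 /\ 0 <= nv (ev m) ^+ 2 by rewrite !sqr_ge0.
  case: m nu2 nv2 => [|m] nu2 nv2 mN.
    by rewrite (snormE ha) eu0 (snormE hb) ev0 mulr0.
  have := en_le _ mN; have := en_ge m.+1; rewrite -/X => h1 h2.
  have h3 : c * nv (ev m.+1) ^+ 2 <= nv (ev m.+1) ^+ 2.
    by rewrite ler_piMl// (le_trans c1').
  have h4 : 0 <= c * nu (eu m.+1) ^+ 2 by rewrite mulr_ge0// ltW.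
  by split; lra.
have KX : c * K ^+ 2 <= X.
  have h t : 0 <= t -> c * t ^+ 2 <= X -> t <= Num.sqrt (X / c).
    by move=> t0 h; rewrite -(ger0_norm t0) -sqrtr_sqr ler_wsqrtr// ler_pdivlMr// mulrC.
  have : K <= Num.sqrt (X / c).
    apply: bigmax_le => [|m _]; first exact: sqrtr_ge0.
    by have [? ?] := Xb m (ltn_ord m); rewrite ge_max !h ?snorm_ge0.
  rewrite -(@ler_pXn2r _ 2) ?nnegrE ?sqrtr_ge0// sqr_sqrtr ?divr_ge0 ?(ltW cp)//.
  by rewrite ler_pdivlMr// mulrC.
set ka := (al + ga) / c + 1.
suff Kd : K <= ka * delta.
  have := K_eu (leqnn N.+1); have := K_ev (leqnn N.+1).
  rewrite -mulrA; lra.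
have cka : c * ka = al + ga + c by rewrite /ka; field; rewrite gt_eqF.
have ka1 : 1 <= ka.
  by rewrite /ka lerDr; apply: divr_ge0; [exact: addr_ge0|exact: ltW].
rewrite leNgt; apply/negP => Kd.
have dK : delta <= K by apply: le_trans (ltW Kd); rewrite ler_peMl.
have Kp : 0 < K by apply: le_lt_trans Kd; rewrite mulr_ge0// (le_trans ler01).
have h1 : c * ka * delta * K < c * K ^+ 2.
  by rewrite expr2 !mulrA ltr_pM2r// -mulrA ltr_pM2l.
have h2 : ga * delta ^+ 2 <= ga * delta * K.
  by rewrite expr2 mulrA ler_wpM2l// mulr_ge0.
have h3 : 0 <= c * delta * K by apply: mulr_ge0 => //; apply: mulr_ge0 => //; exact: ltW.
move: h1 KX; rewrite cka /X; lra.
Qed.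

End Stability.

(** * Convergence of the abstract scheme *)

Section Convergence.
Context (R : rcfType) (U V : lmodType R).
Context (a : U -> U -> R) (b : V -> V -> R).
Context (ha : semi_inner a) (hb : semi_inner b).
Context (L : U -> V) (L' : V -> U) (P : V -> V).
Context (adj : forall w z, b (L w) z = - a w (L' z)).
Context (Psa : forall z z', b (P z) z' = b z (P z')).
Context (Pid : forall z z', b (P z) (P z') = b (P z) z').
Context (n : nat) (e : 'I_n -> U) (lam psi : 'I_n -> R) (tau cT th Cp : R).
Context (eON : forall i j, a (e i) (e j) = (i == j)%:R).
Context (eE : forall w z, a w z = \sum_i a w (e i) * a z (e i)).
Context (tau0 : 0 < tau).
Context (eig : forall i w, tau ^+ 2 * b (P (L (e i))) (L w) = lam i * a (e i) w).
Context (psi0 : forall i, 0 < psi i).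
Context (hcT : forall i, cT <= (psi i)^-1 - lam i / 4).
Context (hCp : forall i, `|(psi i)^-1 - lam i / 4 - 1| <= Cp * lam i).
Context (cT0 : 0 < cT) (cT1 : cT <= 1) (th01 : 0 < th < 1) (Cp0 : 0 <= Cp).
Context (cfl : forall w, tau ^+ 2 * (b (L w) (L w) - b (P (L w)) (L w))
                  <= 4 * cT * th ^+ 2 * a w w).
Local Notation nu := (snorm a).
Local Notation nv := (snorm b).
Local Notation weight_form := (weight_form a b L e psi tau).

Context (N : nat) (uh gu : nat -> U) (vh vb gv : nat -> V).
Context (scheme1 : forall m z, (m <= N)%N ->
  b (vb m - vh m) z = tau / 2 * b (L (uh m)) z + tau / 2 * b (gv m) z).
Context (scheme2 : forall m w, (m <= N)%N -> a (uh m.+1 - uh m) w =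
  tau * \sum_i psi i * a (L' (vb m) + gu m) (e i) * a (e i) w).
Context (scheme3 : forall m z, (m <= N)%N ->
  b (vh m.+1 - vb m) z = tau / 2 * b (L (uh m.+1)) z + tau / 2 * b (gv m) z).

(** The two half steps for v give vb = (v + v')/2 - tau/4 L (u' - u), with the new values
    primed; the last term changes Psi^-1 into G. *)
Lemma scheme_u m w : (m <= N)%N ->
  weight_form (uh m.+1 - uh m) w =
  - (tau / 2) * b (L w) (vh m + vh m.+1) + tau * a (gu m) w.
Proof.
move=> mN.
have vbE z : b z (vb m) = b z (vh m + vh m.+1) / 2 - tau / 4 * b z (L (uh m.+1 - uh m)).
  have := scheme1 z mN; have := scheme3 z mN.
  rewrite (siC hb z (L _)) (bLBl ha adj).
  rewrite !(siC hb z) !(siBl hb) (siDl hb); lra.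
rewrite /weight_form.
have -> : \sum_i (psi i)^-1 * (a (uh m.+1 - uh m) (e i) * a w (e i)) =
    tau * a (L' (vb m) + gu m) w.
  rewrite (eE (L' _ + _)) mulr_sumr; apply: eq_bigr => i _.
  rewrite scheme2// (bigD1 i)//= big1 ?addr0 => [|j ji].
    by rewrite eON eqxx mulr1; field; rewrite gt_eqF.
  by rewrite eON (negPf ji) mulr0.
rewrite (siDl ha) (siC ha (L' _)) -[a w (L' _)]opprK -adj vbE (siC hb (L (_ - _)) (L w)).
by field.
Qed.

Lemma scheme_v m z : (m <= N)%N ->
  b (vh m.+1 - vh m) z = tau / 2 * b (L (uh m + uh m.+1)) z + tau * b (gv m) z.
Proof.
move=> mN; have := scheme1 z mN; have := scheme3 z mN.
rewrite (bLDl ha adj) !(siBl hb); lra.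
Qed.

(** The projected exact solution (uH, vH) satisfies the Crank-Nicolson method without the
    weight G up to small defects; the weight is accounted for by s. *)
Context (uH : nat -> U) (vH : nat -> V) (c1 c2 c3 delta T : R).
Context (c10 : 0 <= c1) (c20 : 0 <= c2) (c30 : 0 <= c3) (d0 : 0 <= delta).
Context (hT : N.+1%:R * tau <= T).
Context (init_u : forall w, a (uH 0%N - uh 0%N) w = 0).
Context (init_v : forall z, b (vH 0%N - vh 0%N) z = 0).
Context (defect_u : forall m w, (m <= N)%N ->
  `|a (uH m.+1 - uH m) w - tau / 2 * (a (L' (vH m)) w + a (L' (vH m.+1)) w)
     - tau * a (gu m) w| <= tau * c1 * delta * nu w).
Context (defect_v : forall m z, (m <= N)%N ->
  `|b (vH m.+1 - vH m) z - tau / 2 * (b (L (uH m)) z + b (L (uH m.+1)) z)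
     - tau * b (gv m) z| <= tau * c1 * delta * nv z).
Context (diff1 : forall m z, (m <= N)%N ->
  tau * `|b (L (uH m.+1)) z - b (L (uH m)) z| <= c2 * delta * nv z).
Context (diff2 : forall m z, (m < N)%N ->
  `|(b (L (uH m.+2)) z - b (L (uH m.+1)) z) - (b (L (uH m.+1)) z - b (L (uH m)) z)|
     <= c3 * delta * nv z).

Let M := coupling b L P e lam psi tau.
Let s m := tau *: M (L (uH m.+1 - uH m)).

Let nv_M y : nv (M y) <= (Cp + 1) * nv y.
Proof. by apply: coupling_le => //; eassumption. Qed.

(* The factor tau in s compensates for the bound of L (u' - u), which is c2 delta / tau. *)
Let nv_s m : (m <= N)%N -> nv (s m) <= (Cp + 1) * c2 * delta.
Proof.
move=> mN; rewrite /s (snormZ hb) (ger0_norm (ltW tau0)).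
have : nv (L (uH m.+1 - uH m)) <= c2 * delta / tau.
  apply: (snorm_le_dual hb) => [|z]; first by rewrite divr_ge0 ?mulr_ge0// ltW.
  rewrite (bLBl ha adj) mulrAC ler_pdivlMr// mulrC; exact: diff1.
rewrite ler_pdivlMr// => h2.
have : tau * nv (M (L (uH m.+1 - uH m))) <= tau * ((Cp + 1) * nv (L (uH m.+1 - uH m))).
  by rewrite ler_wpM2l ?nv_M// ltW.
move/le_trans; apply; rewrite mulrCA -mulrA ler_wpM2l ?addr_ge0//.
by rewrite mulrC.
Qed.

Let nv_sd m : (m < N)%N -> nv (s m.+1 - s m) <= tau * ((Cp + 1) * c3) * delta.
Proof.
move=> mN; rewrite /s -scalerBr (snormZ hb) (ger0_norm (ltW tau0)) -!mulrA.
rewrite ler_wpM2l ?(ltW tau0)//.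
set y := L (uH m.+2 - _); set y' := L _.
apply: (@le_trans _ _ (nv (M (y - y')))).
  apply: (snorm_le_dual hb); first exact: snorm_ge0.
  move=> z; rewrite couplingB//; exact: cauchy_schwarz.
apply: (le_trans (nv_M _)).
rewrite ler_wpM2l ?addr_ge0//.
apply: (snorm_le_dual hb); first exact: mulr_ge0.
by move=> z; rewrite (siBl hb) !(bLBl ha adj); exact: diff2.
Qed.

Theorem convergence :
  nu (uH N.+1 - uh N.+1) + nv (vH N.+1 - vh N.+1) <=
  2 * ((2 * ((Cp + 1) * c2) + 4 * T * c1 + 2 * T * ((Cp + 1) * c3)
     + 2 * T * c1 * ((Cp + 1) * c2)) / (cT * (1 - th ^+ 2)) + 1) * delta.
Proof.
apply: (stability ha hb adj Psa eE tau0 eig hcT cT0 cT1 th01 cfl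
  (eu := fun m => uH m - uh m) (ev := fun m => vH m - vh m) (s := s) (du := fun m w => a (uH m.+1 - uH m) w - tau / 2 * (a (L' (vH m)) w + a (L' (vH m.+1)) w)
     - tau * a (gu m) w)
  (dv := fun m z => b (vH m.+1 - vH m) z - tau / 2 * (b (L (uH m)) z + b (L (uH m.+1)) z)
     - tau * b (gv m) z)) => //; rewrite ?mulr_ge0 ?addr_ge0//.
- move=> m w mN.
  have -> : uH m.+1 - uh m.+1 - (uH m - uh m) = (uH m.+1 - uH m) - (uh m.+1 - uh m).
    by rewrite !opprD !opprK addrACA.
  rewrite (weight_formBl ha adj) scheme_u//.
  have hg x : weight_form x w - a x w = tau ^+ 2 * b (M (L x)) (L w).
    by apply: weight_form_sub_id => //; eassumption.
  have := hg (uH m.+1 - uH m); rewrite /s (siZl hb).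
  rewrite !(siC ha (L' _)) !(siDr hb) !(siNr hb).
  have h z : a w (L' z) = - b (L w) z by rewrite adj opprK.
  rewrite !h; lra.
- move=> m z mN.
  have -> : vH m.+1 - vh m.+1 - (vH m - vh m) = (vH m.+1 - vH m) - (vh m.+1 - vh m).
    by rewrite !opprD !opprK addrACA.
  rewrite (siBl hb) scheme_v//.
  have := bLDl ha adj; have := bLBl ha adj => hB hD.
  rewrite (hD (uH m - uh m)) !hB hD; lra.
Qed.

End Convergence.

(** * Open sets and hyperplanes for Lebesgue measure *)

Section RdMeasure.
Context (R : realType).
Local Notation E d := 'rV[R]_d.

Lemma measurable_coord d (i : 'I_d) : measurable_fun setT (fun x : E d => x ord0 i : R).
Proof.
move=> _ B mB; rewrite setTI; exists ((@tnth _ _)^~ i @^-1` B).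
  by rewrite -[X in measurable X]setTI; exact: measurable_tnth.
rewrite setTI; apply/seteqP; split => x /=; by rewrite tnth_mktuple.
Qed.

Lemma measurable_linear d (a : E d) : measurable_fun setT (fun x : E d => dotr a x).
Proof.
apply: measurable_sum => i; apply: measurable_funM => //; exact: measurable_coord.
Qed.

Lemma measurable_hyperplane d (a : E d) b : measurable (hyperplane a b).
Proof.
by rewrite -[hyperplane _ _]setTI; exact: (measurable_linear a _ (measurable_set1 b)).
Qed.

(** The measurable structure is generated by the coordinates; an open set is the union of
    the cubes with rational centres and radii that it contains. *)
Lemma open_rV_measurable d (A : set (E d)) : open A -> measurable A.
Proof.
move=> oA.
pose Q := ('rV[rat]_d * rat)%type.
pose bx (q : Q) := [set x : E d | forall i, `|ratr (q.1 ord0 i) - x ord0 i| < (ratr q.2 : R)].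
have mbx q : measurable (bx q).
  rewrite (_ : bx q = \bigcap_(i in [set: 'I_d])
      ((fun x : E d => x ord0 i) @^-1` [set y | `|ratr (q.1 ord0 i) - y| < (ratr q.2 : R)])).
    apply: fin_bigcap_measurable => [|i _]; first exact: finite_finset.
    rewrite -[X in measurable X]setTI; apply: measurable_coord => //.
    apply: open_measurable; exact: (@ball_open _ _ (ratr (q.1 ord0 i) : R^o) (ratr q.2)).
  apply/seteqP; split => x /= h i; [move=> _|]; exact: h.
rewrite (_ : A = \bigcup_(q in [set: Q]) (if `[< bx q `<=` A >] then bx q else set0)).
  apply: countable_bigcupT_measurable => [|q]; first exact: countableP.
  by case: ifP.
apply/seteqP; split => [x Ax|x [q _]]; last by case: ifPn => // /asboolP h /h.
have /nbhs_ballP[r/= r0 rA] := open_nbhs_nbhs (conj oA Ax).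
have r2 : 0 < r / 2 by rewrite divr_gt0.
have [p] := rat_in_itvoo r2; rewrite in_itv/= => /andP[p0 pr].
have /choice[c hc] : forall i, exists c : rat, (ratr c : R) \in `]x ord0 i - ratr p, x ord0 i[.
  by move=> i; apply: rat_in_itvoo; rewrite ltrBlDr ltrDl.
have bxx : bx (\row_i c i, p) x.
  move=> i /=; rewrite mxE; have := hc i; rewrite in_itv/= => /andP[h1 h2].
  by rewrite ltr_norml; apply/andP; split; lra.
have bxA : bx (\row_i c i, p) `<=` A.
  move=> y yb; apply: rA; split=> // i j; rewrite (ord1 i).
  have := yb j; have := bxx j; rewrite /= mxE.
  rewrite /ball/= !ltr_norml => /andP[h1 h2] /andP[h3 h4].
  apply/andP; split; lra.
by exists (\row_i c i, p) => //; rewrite ifT//; apply/asboolP.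
Qed.

Lemma tnth_tuple_consS d (p : measurableTypeR R * d.-tuple (measurableTypeR R)) i :
  tnth (tuple_cons p) (lift ord0 i) = tnth p.2 i.
Proof. by rewrite (tnth_nth (tnth_default p.2 i))/= -tnth_nth. Qed.

(** Fubini in the first coordinate. If its coefficient does not vanish, then the sections
    are points. Otherwise the sections are empty off a hyperplane of one dimension less. *)
Lemma hyperplane_tuple_null d (a : 'I_d -> R) b : (exists i, a i != 0) ->
  lebesgue_tuple R d [set t | \sum_(i < d) a i * tnth t i = b] = 0%E.
Proof.
elim: d a b => [|d IH] a b; first by case=> -[].
move=> [i0 ai0].
pose H := [set p : measurableTypeR R * d.-tuple (measurableTypeR R) |
  a ord0 * p.1 + \sum_(i < d) a (lift ord0 i) * tnth p.2 i = b].
have Hpre : @tuple_cons R d @^-1` [set t | \sum_(i < d.+1) a i * tnth t i = b] = H.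
  apply/seteqP; split => [[x t]|[x t]]; rewrite /H/= big_ord_recl/=.
    by under eq_bigr do rewrite tnth_tuple_consS.
  by under [in X in _ -> X]eq_bigr do rewrite tnth_tuple_consS.
have mH : measurable H.
  have mf : measurable_fun setT (fun p : measurableTypeR R * d.-tuple (measurableTypeR R) =>
      a ord0 * p.1 + \sum_(i < d) a (lift ord0 i) * tnth p.2 i).
    apply: measurable_funD.
      by apply: measurable_funM => //; exact: measurable_fst.
    apply: measurable_sum => i; apply: measurable_funM => //.
    apply: (measurableT_comp (measurable_tnth i)); exact: measurable_snd.
  by rewrite -[H]setTI; exact: (mf measurableT _ (measurable_set1 b)).
transitivity ((@lebesgue_measure R \x^ lebesgue_tuple R d)%E H).
  by rewrite -Hpre.
rewrite /product_measure2.
transitivity (\int[lebesgue_tuple R d]_t (0 : \bar R))%E; last exact: integral0.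
apply: ae_eq_integral => //.
  exact: measurable_fun_ysection.
have [a0|a0] := eqVneq (a ord0) 0; last first.
  apply: aeW => t _ /=; rewrite [X in lebesgue_measure X](_ : _ =
     [set (a ord0)^-1 * (b - \sum_(i < d) a (lift ord0 i) * tnth t i)]).
    exact: lebesgue_measure_set1.
  apply/seteqP; split => x; rewrite /ysection/= ?inE /H/=.
    by move=> <-; rewrite addrK mulKf.
  by move=> ->; rewrite mulVKf// subrK.
exists [set t | \sum_(i < d) a (lift ord0 i) * tnth t i = b]; split.
- have mf : measurable_fun setT (fun t : d.-tuple (measurableTypeR R) =>
      \sum_(i < d) a (lift ord0 i) * tnth t i).
    apply: measurable_sum => i; apply: measurable_funM => //; exact: measurable_tnth.
  rewrite -[X in measurable X]setTI; exact: (mf measurableT _ (measurable_set1 b)).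
- apply: IH; have := ai0; case: (unliftP ord0 i0) => [j ->|->]; first by exists j.
  by rewrite a0 eqxx.
- move=> t /=; apply: contra_notP => tH _.
  rewrite [X in lebesgue_measure X](_ : _ = set0) ?measure0//.
  by apply/seteqP; split => x //; rewrite /ysection/= ?inE /H/= a0 mul0r add0r.
Qed.

Lemma hyperplane_null d (a : E d) b : a != 0 -> leb R d (hyperplane a b) = 0%E.
Proof.
move=> a0; transitivity (lebesgue_tuple R d [set t | \sum_(i < d) a ord0 i * tnth t i = b]).
  have dE (t : d.-tuple (measurableTypeR R)) :
      dotr a (tuple_to_rV t) = \sum_(i < d) a ord0 i * tnth t i.
    by apply: eq_bigr => i _; rewrite mxE.
  congr (lebesgue_tuple R d _); apply/seteqP.
  by split=> t /=; rewrite /hyperplane/= dE.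
apply: hyperplane_tuple_null; apply: contrapT => h; move/eqP: a0; apply.
apply/rowP => i; rewrite mxE; apply: contrapT => ai; apply: h; exists i; exact/eqP.
Qed.

End RdMeasure.

(** * Weighted inner products on L2 *)

Section L2Theory.
Context (R : realType) (d : nat).
Local Notation E := 'rV[R]_d.
Local Notation mu := (leb R d).
Context (K : set E) (mK : measurable K).

Definition sqint (f : E -> R) :=
  measurable_fun K f /\ mu.-integrable K (fun x => (f x ^+ 2)%:E).

Lemma sqint_mul f g : sqint f -> sqint g -> mu.-integrable K (fun x => (f x * g x)%:E).
Proof.
move=> [mf sf] [mg sg].
apply: (le_integrable mK _ _ (integrableD mK sf sg)).
  by apply/measurable_EFinP; exact: measurable_funM.
move=> x _ /=; rewrite lee_fin normrM [leRHS]ger0_norm ?addr_ge0 ?sqr_ge0//.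
rewrite -(real_normK (num_real (f x))) -(real_normK (num_real (g x))).
have := sqr_ge0 (`|f x| - `|g x|); have := normr_ge0 (f x); have := normr_ge0 (g x); nra.
Qed.

Lemma sqintD c f g : sqint f -> sqint g -> sqint (fun x => c * f x + g x).
Proof.
move=> hf hg; have [mf sf] := hf; have [mg sg] := hg; split.
  by apply: measurable_funD => //; exact: measurable_funM.
have := integrableD mK (integrableD mK (integrableZl mK (c ^+ 2) sf) sg)
  (integrableZl mK (2 * c) (sqint_mul hf hg)).
by apply: eq_integrable => // x _ /=; congr EFin; ring.
Qed.

(** The weights are bounded only almost everywhere. *)
Lemma integrable_ae_bounded (h g : E -> R) (C : R) :
  measurable_fun K h -> {ae mu, forall x, K x -> `|h x| <= C} ->
  mu.-integrable K (fun x => (g x)%:E) -> mu.-integrable K (fun x => (h x * g x)%:E).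
Proof.
move=> mh hC ig; have ig' := integrable_abse ig.
have /integrableP[mg _] := ig.
have mhg : measurable_fun K (fun x => (h x * g x)%:E).
  by apply/measurable_EFinP; apply: measurable_funM => //; exact/measurable_EFinP.
have /integrableP[_ fin] := integrableZl mK `|C| ig'.
apply/integrableP; split => //; apply: le_lt_trans fin.
apply: ae_ge0_le_integral => //.
- exact: measurableT_comp.
- apply: measurableT_comp => //; apply: measurable_funeM.
  exact: measurableT_comp.
- case: hC => N [mN N0 hN]; exists N; split => // x /= hx; apply: hN => /= h'.
  apply: hx => Kx; rewrite lee_fin !normrM !normr_id ler_wpM2r//.
  by apply: le_trans (h' Kx) _; exact: ler_norm.
Qed.

Context (m : nat).
Implicit Types (w z : E -> 'cV[R]_m).

Lemma L2_sqint w i : L2 K w -> sqint (fun x => w x i ord0).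
Proof. by move=> /(_ i). Qed.

Lemma L2_lin c w z : L2 K w -> L2 K z -> L2 K (c *: w + z).
Proof.
move=> hw hz i; have [h1 h2] := sqintD c (L2_sqint i hw) (L2_sqint i hz).
have -> : (fun x => (c *: w + z) x i ord0) = (fun x => c * w x i ord0 + z x i ord0).
  by apply/funext => x; rewrite !mxE.
split=> //; apply: eq_integrable h2 => // x _ /=.
by rewrite !mxE.
Qed.

Lemma L2_0 : L2 K (0 : E -> 'cV[R]_m).
Proof.
move=> i; have -> : (fun x => (0 : E -> 'cV[R]_m) x i ord0) = cst 0.
  by apply/funext => x; rewrite mxE.
split; first exact: measurable_cst.
apply: eq_integrable (integrable0 mu K) => // x _ /=.
by rewrite !mxE expr0n.
Qed.

Lemma L2D w z : L2 K w -> L2 K z -> L2 K (w + z).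
Proof. by move=> /(L2_lin 1); rewrite scale1r; exact. Qed.

Lemma L2Z c w : L2 K w -> L2 K (c *: w).
Proof. by move=> hw; rewrite -[c *: w]addr0; exact: L2_lin L2_0. Qed.

Lemma L2B w z : L2 K w -> L2 K z -> L2 K (w - z).
Proof. by move=> hw /(L2Z (-1)); rewrite scaleN1r; exact: L2D. Qed.

Context (M : E -> 'M[R]_m) (hM : is_weight K M).

Lemma dotcE (A : 'M[R]_m) (a b : 'cV[R]_m) :
  dotc (A *m a) b = \sum_i \sum_j A i j * (a j ord0 * b i ord0).
Proof.
apply: eq_bigr => i _; rewrite mxE mulr_suml; apply: eq_bigr => j _.
by rewrite mulrA.
Qed.

Lemma ip_integrable w z : L2 K w -> L2 K z ->
  mu.-integrable K (EFin \o (fun x => dotc (M x *m w x) (z x))).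
Proof.
move=> hw hz; have [mM [C hC] _ _] := hM.
have : mu.-integrable K (fun x => \sum_i \sum_j
    (M x i j * (w x j ord0 * z x i ord0))%:E)%E.
  apply: integrable_sum => // i _; apply: integrable_sum => // j _.
  apply: (@integrable_ae_bounded _ _ C) => //.
    apply: filterS hC => x h Kx; exact: h.
  exact: sqint_mul (L2_sqint j hw) (L2_sqint i hz).
apply: eq_integrable => // x _ /=; rewrite dotcE -sumEFin.
by apply: eq_bigr => i _; rewrite -sumEFin.
Qed.

Lemma ip_lin c w w' z : L2 K w -> L2 K w' -> L2 K z ->
  ip M K (c *: w + w') z = c * ip M K w z + ip M K w' z.
Proof.
move=> hw hw' hz; rewrite /ip -RintegralZl ?ip_integrable// -RintegralD//.
- apply: eq_Rintegral => x _; rewrite !dotcE mulr_sumr -big_split/=.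
  apply: eq_bigr => i _; rewrite mulr_sumr -big_split/=; apply: eq_bigr => j _.
  by rewrite !mxE; ring.
- exact: (integrableZl mK c (ip_integrable hw hz)).
- exact: ip_integrable.
Qed.

Lemma Rintegral_ae (f g : E -> R) : mu.-integrable K (EFin \o f) -> mu.-integrable K (EFin \o g) ->
  {ae mu, forall x, K x -> f x = g x} ->
  \int[mu]_(x in K) f x = \int[mu]_(x in K) g x.
Proof.
move=> /integrableP[mf _] /integrableP[mg _] fg; congr fine.
apply: ae_eq_integral => //.
by apply: filterS fg => x h Kx /=; rewrite h.
Qed.

Lemma ip_aeq w w' z : L2 K w -> L2 K w' -> L2 K z -> aeq K w w' ->
  ip M K w z = ip M K w' z.
Proof.
move=> hw hw' hz ww'; apply: Rintegral_ae; [exact: ip_integrable..|].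
by apply: filterS ww' => x h Kx; rewrite h.
Qed.

Lemma ipC w z : L2 K w -> L2 K z -> ip M K w z = ip M K z w.
Proof.
move=> hw hz; have [_ _ hs _] := hM.
apply: Rintegral_ae; [exact: ip_integrable..|].
apply: filterS hs => x h Kx; rewrite !dotcE exchange_big/=.
apply: eq_bigr => i _; apply: eq_bigr => j _.
by rewrite -{1}(h Kx) mxE; ring.
Qed.

(** The integrand is nonnegative only almost everywhere, so it is replaced by its absolute
    value. *)
Lemma ip_ge0 w : L2 K w -> 0 <= ip M K w w.
Proof.
move=> hw; have [_ _ _ [c c0 hp]] := hM; rewrite /ip.
have ii := ip_integrable hw hw.
rewrite (@Rintegral_ae _ (fun x => `|dotc (M x *m w x) (w x)|)) //.
- exact: Rintegral_ge0.
- exact: (integrable_abse ii).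
- apply: filterS hp => x h Kx; rewrite ger0_norm//.
  apply: le_trans (h Kx _); apply: mulr_ge0; first exact: ltW.
  by apply: sumr_ge0 => i _; rewrite -expr2 sqr_ge0.
Qed.

End L2Theory.

Lemma is_weight_sub (R : realType) d (K K' : set 'rV[R]_d) m (M : 'rV[R]_d -> 'M[R]_m) :
  measurable K -> K' `<=` K -> is_weight K M -> is_weight K' M.
Proof.
move=> mK sub [h1 [C h2] h3 [c c0 h4]]; split.
- move=> i j; exact: measurable_funS (h1 i j).
- by exists C; apply: filterS h2 => x h /sub.
- by apply: filterS h3 => x h /sub.
- by exists c => //; apply: filterS h4 => x h /sub.
Qed.

(** * Mesh geometry *)

Section Mesh.
Context (R : realType) (d : nat).
Local Notation E := 'rV[R]_d.
Local Notation mu := (leb R d).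
Context (Om : set E) (hOm : polyhedral Om).

Lemma polyhedral_open (K : set E) : polyhedral K -> open K. Proof. by case. Qed.

Lemma polyhedral_measurable (K : set E) : polyhedral K -> measurable K.
Proof. by move=> /polyhedral_open; exact: open_rV_measurable. Qed.

Lemma negligible_bigcup_ord n (F : 'I_n -> set E) :
  (forall i, mu.-negligible (F i)) -> mu.-negligible (\bigcup_(i in [set: 'I_n]) F i).
Proof.
move=> F0; pose G k := if insub k is Some i then F i else set0.
apply: (@negligibleS _ _ _ _ (\bigcup_k G k)).
  by move=> x [i _ xi]; exists (val i) => //; rewrite /G valK.
by apply: negligible_bigcup => k; rewrite /G; case: insub => // *; exact: negligible_set0.
Qed.

Lemma polyhedral_boundary_null (K : set E) : polyhedral K ->
  mu.-negligible (closure K `\` K).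
Proof.
case=> _ _ _ _ [_ [n [a [b [a0 sub]]]]].
apply: (negligibleS sub); apply: negligible_bigcup_ord => i.
exists (hyperplane (a i) (b i)); split=> //; first exact: measurable_hyperplane.
exact: hyperplane_null.
Qed.

Lemma enorm_le (x : E) (r : R) : 0 <= r -> `|x| <= r -> enorm x <= Num.sqrt d%:R * r.
Proof.
move=> r0 xr; rewrite /enorm -[X in _ * X](ger0_norm r0) -sqrtr_sqr -sqrtrM//.
apply: ler_wsqrtr; rewrite /dotr.
apply: (@le_trans _ _ (\sum_(i < d) r ^+ 2)); last first.
  by rewrite sumr_const card_ord mulr_natl.
apply: ler_sum => i _; rewrite -expr2 -(real_normK (num_real _)).
rewrite ler_pXn2r ?nnegrE//; apply: le_trans xr.
rewrite [leRHS]mx_normrE.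
exact: (le_bigmax _ (fun ij => `|x ij.1 ij.2|) (ord0, i)).
Qed.

(** The bound from above makes h^(k+1) at most a constant times h^k with a constant that
    depends only on Om. *)
Lemma diameter_bound : exists2 D : R, 0 <= D &
  forall K : set E, K !=set0 -> K `<=` Om ->
    0 <= diameter K <= D.
Proof.
have [_ _ _ [M0 [_ hM0]] _] := hOm.
pose M := `|M0| + 1.
have hM x : Om x -> `|x| <= M.
  by apply: hM0; rewrite /M (le_lt_trans (ler_norm M0))// ltrDl.
have M_ge0 : 0 <= M by rewrite addr_ge0.
exists (Num.sqrt d%:R * (M + M)); first by rewrite mulr_ge0 ?sqrtr_ge0 ?addr_ge0.
move=> K [x0 Kx0] sub.
pose S := [set r | exists x y, [/\ K x, K y & r = enorm (x - y)]].
rewrite (_ : diameter K = sup S)//.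
have Sx0 : S 0.
  by exists x0, x0; split=> //; rewrite subrr /enorm /dotr big1 ?sqrtr0// => i _; rewrite mxE mul0r.
have Sub r : S r -> r <= Num.sqrt d%:R * (M + M).
  move=> [x [y [Kx Ky ->]]]; apply: enorm_le; first exact: addr_ge0.
  by apply: le_trans (ler_normB _ _) _; apply: lerD; apply: hM; exact: sub.
apply/andP; split; last by apply: ge_sup => //; exists 0.
by apply: ub_le_sup => //; exists (Num.sqrt d%:R * (M + M)) => r /Sub.
Qed.

Context (N : nat) (Th : 'I_N -> set E) (hTh : is_mesh Om Th).

Lemma mesh_polyhedral K : polyhedral (Th K). Proof. by case: hTh. Qed.

(** The element is open and contained in the closure of Om, hence in its interior, and the
    interior of the closure is Om because Om lies on one side of its boundary. *)
Lemma mesh_sub K : Th K `<=` Om.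
Proof.
have [_ _ cl] := hTh; have [_ _ _ _ [-> _]] := hOm.
have oK : open (Th K) by case: (mesh_polyhedral K).
rewrite -[X in X `<=` _](interior_id _).1//.
apply: interiorS => x Kx; rewrite cl; exists K => //; exact: subset_closure.
Qed.

(** A point of Om outside the elements is on the boundary of one of them. *)
Lemma mesh_cover_null : mu.-negligible (Om `\` \bigcup_(K in [set: 'I_N]) Th K).
Proof.
have [_ _ cl] := hTh.
apply: (@negligibleS _ _ _ _ (\bigcup_(K in [set: 'I_N]) (closure (Th K) `\` Th K))).
  move=> x [Ox nx]; have : closure Om x by exact: subset_closure.
  rewrite cl => -[K _ Kx]; exists K => //; split=> // Tx; apply: nx; by exists K.
apply: negligible_bigcup_ord => K; apply: polyhedral_boundary_null.
exact: mesh_polyhedral.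
Qed.

Lemma diameter_le_mesh_size K : diameter (Th K) <= mesh_size Th.
Proof. exact: le_bigmax. Qed.

Lemma mesh_size_ge0 : 0 <= mesh_size Th.
Proof. exact: bigmax_ge_id. Qed.

Lemma diameter_ge0 K : 0 <= diameter (Th K).
Proof.
have [D _ h] := diameter_bound.
have [ne _ _ _ _] := mesh_polyhedral K.
by have /andP[] := h _ ne (@mesh_sub K).
Qed.

Lemma mesh_size_le D : 0 <= D -> (forall K, diameter (Th K) <= D) -> mesh_size Th <= D.
Proof. by move=> D0 h; apply: bigmax_le. Qed.

End Mesh.

(** * Piecewise polynomials and cut-offs *)

Section DiscreteSpace.
Context (R : realType) (d : nat).
Local Notation E := 'rV[R]_d.
Local Notation mu := (leb R d).
Context (Om : set E) (hOm : polyhedral Om).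
Context (N : nat) (Th : 'I_N -> set E) (hTh : is_mesh Om Th) (k m : nat).
Implicit Types (w z : E -> 'cV[R]_m) (S : {set 'I_N}).
Local Notation V := (Vh Om Th k (m := m)).

Let mOm : measurable Om. Proof. exact: polyhedral_measurable. Qed.

Lemma Vh_L2 w : V w -> L2 Om w. Proof. by case. Qed.

Lemma Vh_0 : V 0.
Proof.
split=> [|K j]; first exact: L2_0.
exists (fun=> 0); apply: aeW => x _.
by rewrite big1 => [|i _]; rewrite ?mul0r// mxE.
Qed.

Lemma Vh_lin c w z : V w -> V z -> V (c *: w + z).
Proof.
move=> [w2 wp] [z2 zp]; split; first exact: L2_lin.
move=> K j; have [p hp] := wp K j; have [q hq] := zp K j.
exists (fun al => c * p al + q al).
apply: filterS2 hp hq => x hp hq Kx; rewrite !mxE hp// hq// mulr_sumr -big_split/=.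
by apply: eq_bigr => al _; ring.
Qed.

Lemma Vh_D w z : V w -> V z -> V (w + z).
Proof. by move=> /(Vh_lin 1); rewrite scale1r; exact. Qed.

Lemma Vh_Z c w : V w -> V (c *: w).
Proof. by move=> hw; rewrite -[c *: w]addr0; exact: Vh_lin Vh_0. Qed.

Let measurable_Th S : measurable (\bigcup_(K in [set` S]) Th K).
Proof.
apply: fin_bigcup_measurable => [|K _]; first exact: finite_finset.
exact: (polyhedral_measurable (mesh_polyhedral hTh K)).
Qed.

Lemma chi_in S w x : (\bigcup_(K in [set` S]) Th K) x -> chi Th S w x = w x.
Proof. by move=> h; rewrite /chi indicE mem_set// scale1r. Qed.

Lemma chi_out S w x : ~ (\bigcup_(K in [set` S]) Th K) x -> chi Th S w x = 0.
Proof. by move=> h; rewrite /chi indicE memNset// scale0r. Qed.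

Lemma chi_L2 S w : L2 Om w -> L2 Om (chi Th S w).
Proof.
move=> hw i; have [mw iw] := hw i.
have mc : measurable_fun Om (fun x => chi Th S w x i ord0).
  rewrite [X in measurable_fun _ X](_ : _ =
    fun x => (\1_(\bigcup_(K in [set` S]) Th K) x : R) * w x i ord0); last first.
    by apply/funext => x; rewrite /chi mxE.
  by apply: measurable_funM => //; apply: measurable_indic.
split=> //; apply: le_integrable iw => //.
  by apply/measurable_EFinP; exact: measurable_funX.
move=> x _; rewrite lee_fin !normrX ler_pXn2r ?nnegrE//.
have [h|h] := pselect ((\bigcup_(K in [set` S]) Th K) x).
  by rewrite chi_in.
by rewrite chi_out// mxE normr0.
Qed.

Lemma chi_Vh S w : V w -> V (chi Th S w).
Proof.
move=> [w2 wp]; split; first exact: chi_L2.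
move=> K j; have [KS|KS] := boolP (K \in S).
  have [c hc] := wp K j; exists c; apply: filterS hc => x h Kx.
  by rewrite chi_in ?h//; exists K.
exists (fun=> 0); apply: aeW => x Kx.
rewrite big1 => [|i _]; last by rewrite mul0r.
rewrite chi_out ?mxE// => -[K' /= K'S K'x].
have KK' : K != K' by apply: contraNneq KS => ->.
have [_ dis _] := hTh; have : (Th K `&` Th K') x by [].
by rewrite dis.
Qed.

Context (M : E -> 'M[R]_m) (hM : is_weight Om M).

Lemma dotcZl (a b : 'cV[R]_m) (c : R) : dotc (c *: a) b = c * dotc a b.
Proof. by rewrite /dotc mulr_sumr; apply: eq_bigr => i _; rewrite mxE mulrA. Qed.

Lemma dotcZr (a b : 'cV[R]_m) (c : R) : dotc a (c *: b) = c * dotc a b.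
Proof. by rewrite /dotc mulr_sumr; apply: eq_bigr => i _; rewrite mxE mulrCA. Qed.

Lemma ip_chi_sym S w z : ip M Om (chi Th S w) z = ip M Om w (chi Th S z).
Proof.
by apply: eq_Rintegral => x _; rewrite /chi -scalemxAr dotcZl dotcZr.
Qed.

Lemma ip_chi_idem S w z : ip M Om (chi Th S w) (chi Th S z) = ip M Om (chi Th S w) z.
Proof.
apply: eq_Rintegral => x _.
have [h|h] := pselect ((\bigcup_(K in [set` S]) Th K) x); first by rewrite !chi_in.
by rewrite !chi_out// mulmx0 /dotc !big1// => i _; rewrite mxE mul0r.
Qed.

(** The fine and the coarse elements together exhaust Om up to a null set. *)
Lemma ip_chi_compl S w z : L2 Om w -> L2 Om z ->
  ip M Om (chi Th (~: S) w) z = ip M Om w z - ip M Om (chi Th S w) z.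
Proof.
move=> hw hz; have hc := chi_L2 S hw; have hc' := chi_L2 (~: S) hw.
apply/esym/eqP; rewrite subr_eq; apply/eqP.
have := ip_lin mOm hM 1 hc' hc hz; rewrite scale1r mul1r => <-.
apply: ip_aeq => //; first exact: L2D.
rewrite /aeq; have [Z [mZ Z0 hZ]] := mesh_cover_null hTh.
exists Z; split=> // x /= hx; apply: hZ; split.
  by apply: contrapT => Ox; apply: hx.
move=> [K _ Kx]; apply: hx => Ox.
rewrite [RHS]/GRing.add/=.
have dis K' : Th K' x -> K' = K.
  move=> K'x; apply/eqP; apply: contrapT => /negP KK'.
  have [_ h _] := hTh; have : (Th K' `&` Th K) x by [].
  by rewrite h.
have [KS|KS] := boolP (K \in S).
  rewrite chi_out ?chi_in ?add0r//; first by exists K.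
  by move=> [K' /= + /dis KK']; rewrite KK' inE KS.
rewrite chi_in ?chi_out ?addr0//.
  by move=> [K' /= + /dis KK']; rewrite KK' (negPf KS).
by exists K => //=; rewrite inE.
Qed.

End DiscreteSpace.

(** * Linear sets as modules *)

(** A linear set of functions as a module of its own:
    the inner products are then bilinear without side conditions on integrability. *)
Section SubModule.
Context (R : realType) (V : lmodType R).

Definition lin_closed (X : set V) : Prop :=
  X 0 /\ forall c w z, X w -> X z -> X (c *: w + z).

Definition lin_pred (X : set V) (hX : lin_closed X) : {pred V} :=
  [pred w | `[< X w >]].

Context (X : set V) (hX : lin_closed X).

Lemma lin_pred_submod : submod_closed (lin_pred hX).
Proof.
split=> [|c w z]; first by apply/asboolP; case: hX.
by move=> /asboolP Xw /asboolP Xz; apply/asboolP; case: hX => _; exact.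
Qed.

HB.instance Definition _ :=
  GRing.isSubmodClosed.Build R V (lin_pred hX) lin_pred_submod.

Record submod := SubMod { submod_val : V ; _ : submod_val \in lin_pred hX }.

HB.instance Definition _ := [isSub for submod_val].
HB.instance Definition _ := [Choice of submod by <:].
HB.instance Definition _ := [SubChoice_isSubLmodule of submod by <:].

Lemma submodP (w : submod) : X (val w).
Proof. by apply/asboolP; exact: (valP w). Qed.

Definition to_submod (w : V) : submod := insubd (0 : submod) w.

Lemma to_submodK w : X w -> val (to_submod w) = w.
Proof. by move=> Xw; apply: insubdK; apply/asboolP. Qed.

End SubModule.

(** * Taylor estimates with one-sided derivatives *)

Section Taylor.
Context (R : realType).
Implicit Types (f g : R -> R) (x y t B c : R).

Definition derivative_on (I : set R) (f f' : R -> R) : Prop :=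
  derivative_in (V := R^o) (fun z : R => `|z|) I f f'.

Definition seg x y : set R := [set t | x <= t <= y].

Lemma derivative_onS (I J : set R) f f' : J `<=` I -> derivative_on I f f' -> derivative_on J f f'.
Proof.
move=> JI h t Jt e e0; have [dl dl0 hd] := h t (JI _ Jt) e e0.
by exists dl => // s /JI; exact: hd.
Qed.

Lemma derivative_on_lin I c f f' g g' : derivative_on I f f' -> derivative_on I g g' ->
  derivative_on I (fun s => c * f s + g s) (fun s => c * f' s + g' s).
Proof.
move=> hf hg t It e e0.
have c1 : 0 < `|c| + 1 by rewrite ltr_wpDl.
have ec : 0 < e / (`|c| + 1) / 2 by rewrite !divr_gt0.
have e2 : 0 < e / 2 by rewrite divr_gt0.
have [d1 d10 h1] := hf t It _ ec; have [d2 d20 h2] := hg t It _ e2.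
exists (Num.min d1 d2); first by rewrite lt_min d10.
move=> s Is; rewrite lt_min => /andP[s1 s2].
have := h1 s Is s1; have := h2 s Is s2; rewrite /GRing.scale/= => H2 H1.
rewrite [X in `|X|](_ : _ = c * (f s - f t - (s - t) * f' t)
  + (g s - g t - (s - t) * g' t)); last by ring.
apply: le_trans (ler_normD _ _) _; rewrite normrM.
have : `|c| * `|f s - f t - (s - t) * f' t| <= (`|c| + 1) * (e / (`|c| + 1) / 2 * `|s - t|).
  by apply: ler_pM => //; rewrite lerDl.
rewrite (_ : (`|c| + 1) * (_ * _) = e / 2 * `|s - t|); last by field; rewrite gt_eqF.
lra.
Qed.

Lemma derivative_on_id I : derivative_on I (fun s => s) (fun=> 1).
Proof.
move=> t It e e0; exists 1 => // s Is _.
by rewrite /GRing.scale/= mulr1 subrr normr0 mulr_ge0// ltW.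
Qed.

Lemma derivative_on_continuous I f f' t e : derivative_on I f f' -> I t -> 0 < e ->
  exists2 dl, 0 < dl & forall s, I s -> `|s - t| < dl -> `|f s - f t| <= e.
Proof.
move=> h It e0; have [d1 d10 h1] := h t It 1 ltr01.
have p : 0 < 1 + `|f' t| by rewrite ltr_pwDl.
exists (Num.min d1 (e / (1 + `|f' t|))); first by rewrite lt_min d10 divr_gt0.
move=> s Is; rewrite lt_min => /andP[s1 s2].
have := h1 s Is s1; rewrite /GRing.scale/= mul1r => H.
rewrite (_ : f s - f t = (f s - f t - (s - t) * f' t) + (s - t) * f' t); last by ring.
apply: le_trans (ler_normD _ _) _; rewrite normrM.
by move: s2; rewrite ltr_pdivlMr// => s2; lra.
Qed.

Lemma derivative_on_mulX I x f f' : derivative_on I f f' ->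
  derivative_on I (fun s => (s - x) * f s) (fun s => f s + (s - x) * f' s).
Proof.
move=> h t It e e0.
have e2 : 0 < e / 2 by rewrite divr_gt0.
have [d1 d10 h1] := derivative_on_continuous h It e2.
have p : 0 < `|t - x| + 1 by rewrite ltr_wpDl.
have ec : 0 < e / 2 / (`|t - x| + 1) by rewrite !divr_gt0.
have [d2 d20 h2] := h t It _ ec.
exists (Num.min d1 d2); first by rewrite lt_min d10.
move=> s Is; rewrite lt_min => /andP[s1 s2].
have := h1 s Is s1; have := h2 s Is s2; rewrite /GRing.scale/= => H2 H1.
rewrite [X in `|X|](_ : _ = (s - t) * (f s - f t) +
  (t - x) * (f s - f t - (s - t) * f' t)); last by ring.
apply: le_trans (ler_normD _ _) _; rewrite !normrM.
have : `|t - x| * `|f s - f t - (s - t) * f' t| <=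
    (`|t - x| + 1) * (e / 2 / (`|t - x| + 1) * `|s - t|).
  by apply: ler_pM => //; rewrite lerDl.
rewrite (_ : (_ + 1) * (_ * _) = e / 2 * `|s - t|); last by field; rewrite gt_eqF.
have : `|s - t| * `|f s - f t| <= `|s - t| * (e / 2) by apply: ler_wpM2l.
lra.
Qed.

(** In the interior of the segment, f has a derivative in the usual sense, and at the end
    points it is continuous from one side, which is all that the mean value theorem needs. *)
Lemma mean_value_le x y f f' B : x <= y -> derivative_on (seg x y) f f' ->
  (forall t, seg x y t -> `|f' t| <= B) -> `|f y - f x| <= B * (y - x).
Proof.
rewrite le_eqVlt => /orP[/eqP->|xy] h hB; first by rewrite !subrr normr0 mulr0.
have near_seg t e : seg x y t -> 0 < e ->
    \forall s \near t, seg x y s -> `|f t - f s| <= e.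
  move=> st e0; have [dl dl0 hd] := derivative_on_continuous h st e0.
  apply/nbhs_ballP; exists dl => //= s; rewrite /ball/= => ts ss.
  by rewrite distrC hd// distrC.
have der t : t \in `]x, y[ -> is_derive t 1 f (f' t).
  rewrite in_itv/= => /andP[xt ty].
  have st : seg x y t by rewrite /seg/= !ltW.
  have cv : (fun u => u^-1 *: (f (u *: (1 : R^o) + t) - f t)) @ (0 : R^o)^' --> f' t.
    apply/cvgrPdist_le => e e0.
    have [dl dl0 hd] := h t st e e0.
    have d0 : 0 < Num.min dl (Num.min (t - x) (y - t)) by rewrite !lt_min dl0 !subr_gt0 xt.
    near=> u.
    have u0 : u != 0 by near: u; exact: nbhs_dnbhs_neq.
    have : `|u| < Num.min dl (Num.min (t - x) (y - t)) by near: u; apply: dnbhs0_lt.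
    rewrite !lt_min => /and3P[u1 u2 u3].
    have su : seg x y (u + t).
      by move: u2 u3; rewrite /seg/= !ltr_norml => /andP[? ?] /andP[? ?]; apply/andP; split; lra.
    have := hd _ su; rewrite addrK => /(_ u1); rewrite /GRing.scale/= mulr1 => H.
    rewrite (_ : f' t - _ = - u^-1 * (f (u + t) - f t - u * f' t)); last by field.
    by rewrite normrM normrN normfV ler_pdivrMl ?normr_gt0// [leRHS]mulrC.
  apply: DeriveDef; first by apply/cvg_ex; exists (f' t).
  exact: (cvg_lim (@norm_hausdorff _ _) cv).
have cont : {within `[x, y], continuous f}.
  apply/(continuous_within_itvP _ xy); split.
  - move=> t tx; have := der t tx => /@ex_derive /derivable1_diffP.
    exact: differentiable_continuous.
  - apply/cvgrPdist_le => e e0; near=> s.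
    have ss : seg x y s by rewrite /seg/=; apply/andP; split; apply/ltW; near: s;
      [exact: nbhs_right_gt|exact: nbhs_right_lt].
    move: ss; near: s; apply: cvg_within; apply: near_seg => //.
    by rewrite /seg/= lexx ltW.
  - apply/cvgrPdist_le => e e0; near=> s.
    have ss : seg x y s by rewrite /seg/=; apply/andP; split; apply/ltW; near: s;
      [exact: nbhs_left_gt|exact: nbhs_left_lt].
    move: ss; near: s; apply: cvg_within; apply: near_seg => //.
    by rewrite /seg/= lexx ltW.
have [c] := MVT xy der cont; rewrite in_itv/= => /andP[xc cy] ->.
rewrite normrM (ger0_norm (_ : 0 <= y - x)) ?subr_ge0 ?(ltW xy)//.
by rewrite ler_wpM2r ?subr_ge0 ?(ltW xy)// hB// /seg/= !ltW.
Unshelve. all: by end_near. Qed.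

Context (a b : R).
Local Notation I := (seg a b).

Lemma mean_value_dist x y f f' B : I x -> I y -> derivative_on I f f' ->
  (forall t, I t -> `|t - x| <= `|y - x| -> `|f' t| <= B) ->
  `|f y - f x| <= B * `|y - x|.
Proof.
move=> /andP[ax xb] /andP[ay yb] h hB.
have [xy|yx] := leP x y.
  rewrite [X in _ * X]ger0_norm ?subr_ge0//; apply: mean_value_le => //.
    apply: derivative_onS h => t /andP[? ?]; apply/andP; split; lra.
  move=> t /andP[xt ty]; apply: hB; first by apply/andP; split; lra.
  by rewrite !ger0_norm ?subr_ge0// lerB.
rewrite distrC [X in _ * X]distrC [X in _ * X]ger0_norm ?subr_ge0 ?(ltW yx)//.
apply: (mean_value_le (ltW yx)) => //.
  apply: derivative_onS h => t /andP[? ?]; apply/andP; split; lra.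
move=> t /andP[yt tx]; apply: hB; first by apply/andP; split; lra.
rewrite distrC [leRHS]distrC !ger0_norm ?subr_ge0 ?(ltW yx)//; lra.
Qed.

(** The mean value inequality for s |-> f s - s * f' x. *)
Lemma taylor2 x y f f' f'' B : I x -> I y -> derivative_on I f f' -> derivative_on I f' f'' ->
  (forall t, I t -> `|f'' t| <= B) ->
  `|f y - f x - (y - x) * f' x| <= B * `|y - x| ^+ 2.
Proof.
move=> Ix Iy h h' hB.
have hg := derivative_on_lin (- f' x) (@derivative_on_id I) h.
have := mean_value_dist Ix Iy hg.
move=> /(_ (B * `|y - x|)); rewrite expr2 mulrA.
rewrite (_ : - f' x * y + f y - _ = f y - f x - (y - x) * f' x); last by ring.
apply=> t It tx; rewrite mulr1 addrC.
apply: (@le_trans _ _ (B * `|t - x|)).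
  by apply: (mean_value_dist Ix It h') => s Is _; exact: hB.
by apply: ler_wpM2l => //; apply: le_trans (hB _ Ix).
Qed.

(** As a function of y, the error has the derivative
    (f1 y - f1 x - (y - x) * f2 y) / 2, which is a first order Taylor remainder at y. *)
Lemma trapezoid x y f f1 f2 f3 B : I x -> I y ->
  derivative_on I f f1 -> derivative_on I f1 f2 -> derivative_on I f2 f3 ->
  (forall t, I t -> `|f3 t| <= B) ->
  `|f y - f x - (y - x) / 2 * (f1 x + f1 y)| <= B * `|y - x| ^+ 3.
Proof.
move=> Ix Iy h1 h2 h3 hB.
have hg := derivative_on_lin (- 2^-1) (derivative_on_lin (f1 x) (@derivative_on_id I) (derivative_on_mulX x h2)) h1.
have := mean_value_dist Ix Iy hg.
move=> /(_ (B * `|y - x| ^+ 2)); rewrite -mulrA -exprSr.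
rewrite [X in `|X| <= _](_ : _ = f y - f x - (y - x) / 2 * (f1 x + f1 y)); last by field.
apply=> t It tx.
rewrite [X in `|X|](_ : _ = - 2^-1 * (f1 x - f1 t - (x - t) * f2 t)); last by field.
have := taylor2 It Ix h2 h3 hB; rewrite (distrC x t) => H.
have B0 : 0 <= B by apply: le_trans (hB _ Ix).
rewrite normrM normrN (ger0_norm (_ : 0 <= 2^-1 :> R)) ?invr_ge0//.
have : B * `|t - x| ^+ 2 <= B * `|y - x| ^+ 2.
  by apply: ler_wpM2l => //; rewrite ler_pXn2r ?nnegrE.
have := normr_ge0 (f1 x - f1 t - (x - t) * f2 t); lra.
Qed.

Lemma second_difference x tau f f1 f2 B : I (x - tau) -> I x -> I (x + tau) ->
  derivative_on I f f1 -> derivative_on I f1 f2 -> (forall t, I t -> `|f2 t| <= B) ->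
  `|(f (x + tau) - f x) - (f x - f (x - tau))| <= 2 * B * tau ^+ 2.
Proof.
move=> I1 I2 I3 h1 h2 hB.
have H1 := taylor2 I2 I1 h1 h2 hB; have H2 := taylor2 I2 I3 h1 h2 hB.
rewrite (_ : x - tau - x = - tau) ?normrN ?real_normK ?num_real// in H1; last by ring.
rewrite (_ : x + tau - x = tau) ?real_normK ?num_real// in H2; last by ring.
rewrite [X in `|X|](_ : _ = (f (x + tau) - f x - tau * f1 x) +
   (f (x - tau) - f x - (- tau) * f1 x)); last by ring.
apply: le_trans (ler_normD _ _) _; lra.
Qed.

End Taylor.

(** * Testing functions with values in L2 *)

Section InnerProduct.
Context (R : realType) (d : nat).
Local Notation E := 'rV[R]_d.
Context (Om : set E) (mOm : measurable Om) (m : nat).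
Context (M : E -> 'M[R]_m) (hM : is_weight Om M).
Implicit Types (w z : E -> 'cV[R]_m) (c : R).

Lemma ip_semi_inner (X : set (E -> 'cV[R]_m)) (hX : lin_closed X) :
  X `<=` L2 Om (m := m) ->
  semi_inner (fun x y : submod hX => ip M Om (val x) (val y)).
Proof.
move=> XL2; have h x : L2 Om (val (x : submod hX)) by apply: XL2; exact: submodP.
split=> [c x y z|x y|x].
- rewrite linearP/=; exact: (ip_lin mOm hM c (h x) (h y) (h z)).
- exact: (ipC mOm hM (h x) (h y)).
- exact: (ip_ge0 mOm hM (h x)).
Qed.

Lemma L2_closed : lin_closed (L2 Om (m := m)).
Proof. by split=> [|c w z]; [exact: L2_0|exact: L2_lin]. Qed.

Let siL2 := ip_semi_inner L2_closed (@subset_refl _ _).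

Lemma ipDl w w' z : L2 Om w -> L2 Om w' -> L2 Om z ->
  ip M Om (w + w') z = ip M Om w z + ip M Om w' z.
Proof. by move=> hw hw' hz; have := ip_lin mOm hM 1 hw hw' hz; rewrite scale1r mul1r. Qed.

Lemma ip0l z : L2 Om z -> ip M Om 0 z = 0.
Proof.
move=> hz; have := ipDl (@L2_0 _ _ _ mOm _) (@L2_0 _ _ _ mOm _) hz; rewrite addr0.
by move/eqP; rewrite -subr_eq subrr => /eqP.
Qed.

Lemma ipZl c w z : L2 Om w -> L2 Om z -> ip M Om (c *: w) z = c * ip M Om w z.
Proof.
move=> hw hz; have := ip_lin mOm hM c hw (@L2_0 _ _ _ mOm _) hz.
by rewrite addr0 ip0l// addr0.
Qed.

Lemma ipBl w w' z : L2 Om w -> L2 Om w' -> L2 Om z ->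
  ip M Om (w - w') z = ip M Om w z - ip M Om w' z.
Proof.
move=> hw hw' hz; rewrite -scaleN1r ipDl//; last exact: L2Z.
by rewrite ipZl// mulN1r.
Qed.

Lemma ip_cauchy_schwarz w z : L2 Om w -> L2 Om z -> `|ip M Om w z| <= nrm M Om w * nrm M Om z.
Proof.
move=> hw hz; have := cauchy_schwarz siL2 (to_submod L2_closed w) (to_submod L2_closed z).
by rewrite /snorm !to_submodK.
Qed.

Lemma nrm_ge0 w : 0 <= nrm M Om w. Proof. exact: sqrtr_ge0. Qed.

Lemma nrmD w z : L2 Om w -> L2 Om z ->
  nrm M Om (w + z) <= nrm M Om w + nrm M Om z.
Proof.
move=> hw hz; have := snormD siL2 (to_submod L2_closed w) (to_submod L2_closed z).
by rewrite /snorm raddfD/= !to_submodK.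
Qed.

Lemma nrmZ c w : L2 Om w -> nrm M Om (c *: w) = `|c| * nrm M Om w.
Proof.
move=> hw; have := snormZ siL2 c (to_submod L2_closed w).
by rewrite /snorm linearZ/= !to_submodK.
Qed.

Lemma nrmE w : L2 Om w -> nrm M Om w ^+ 2 = ip M Om w w.
Proof. by move=> hw; rewrite sqr_sqrtr//; exact: ip_ge0. Qed.

(** Testing with a fixed z reduces the calculus of L2-valued functions to that of scalar
    functions; estimates that are uniform in z go back to the norm. *)
Lemma derivative_on_ip (I : set R) (f f' : R -> E -> 'cV[R]_m) z :
  (forall t, I t -> L2 Om (f t)) -> (forall t, I t -> L2 Om (f' t)) -> L2 Om z ->
  derivative_in (nrm M Om) I f f' ->
  derivative_on I (fun t => ip M Om (f t) z) (fun t => ip M Om (f' t) z).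
Proof.
move=> hf hf' hz h t It e e0.
have c0 : 0 < nrm M Om z + 1 by rewrite ltr_wpDl ?nrm_ge0.
have ec : 0 < e / (nrm M Om z + 1) by rewrite divr_gt0.
have [dl dl0 hd] := h t It _ ec; exists dl => // s Is st.
have := hd s Is st; rewrite /GRing.scale/= => H.
have L1 := L2B mOm (hf _ Is) (hf _ It); have L3 := L2Z mOm (s - t) (hf' _ It).
rewrite (_ : _ - _ - _ = ip M Om (f s - f t - (s - t) *: f' t) z).
  apply: le_trans (ip_cauchy_schwarz _ hz) _; first exact: L2B.
  apply: (@le_trans _ _ (e / (nrm M Om z + 1) * `|s - t| * (nrm M Om z + 1))).
    by apply: ler_pM; rewrite ?nrm_ge0// lerDl.
  rewrite [leLHS](_ : _ = e * `|s - t|)//; field; exact: lt0r_neq0.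
have It' := hf' _ It; have Is' := hf _ Is; have It'' := hf _ It.
by rewrite !ipBl// ipZl.
Qed.

End InnerProduct.

(** * Broken seminorms *)

Lemma le_sqrt_addl (R : realType) (s x : R) : 0 <= s -> x <= Num.sqrt (s + x ^+ 2).
Proof.
move=> s0; apply: le_trans (ler_norm x) _.
by rewrite -sqrtr_sqr ler_wsqrtr// lerDr.
Qed.

Section BrokenNorms.
Context (R : realType) (d : nat).
Local Notation E := 'rV[R]_d.
Context (Om : set E) (hOm : polyhedral Om).
Context (N : nat) (Th : 'I_N -> set E) (hTh : is_mesh Om Th) (m : nat).
Context (M : E -> 'M[R]_m) (hM : is_weight Om M).
Implicit Types (w : E -> 'cV[R]_m).

Lemma weak_derivative_L2 (K : set E) al w : measurable K -> L2 K (weak_derivative K al w).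
Proof.
move=> mK; rewrite /weak_derivative; case: xgetP => [g _ [] //|_]; exact: L2_0.
Qed.

Lemma broken_seminorm_le s j w :
  broken_seminorm Th M s j w <= mesh_size Th ^+ s * broken_seminorm Th M 0 j w.
Proof.
have h0 := mesh_size_ge0 Th.
rewrite /broken_seminorm -[X in X * _](ger0_norm (exprn_ge0 s h0)) -sqrtr_sqr -sqrtrM ?sqr_ge0//.
apply: ler_wsqrtr; rewrite mulr_sumr; apply: ler_sum => K _.
rewrite mulr_sumr; apply: ler_sum => al _.
have mK : measurable (Th K) := polyhedral_measurable (mesh_polyhedral hTh K).
have hMK := is_weight_sub (polyhedral_measurable hOm) (mesh_sub hOm hTh (K := K)) hM.
have wL := weak_derivative_L2 (fun i => al i : nat) w mK.
have dK := diameter_ge0 hOm hTh K.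
rewrite expr0 scale1r (nrmZ mK hMK _ wL) exprMn ler_wpM2r ?sqr_ge0//.
rewrite ger0_norm ?exprn_ge0// ler_pXn2r ?nnegrE ?exprn_ge0//.
by apply: lerXn2r; rewrite ?nnegrE//; exact: diameter_le_mesh_size.
Qed.

Lemma broken_seminorm_le_norm j l w : (j <= l)%N ->
  broken_seminorm Th M 0 j w <= broken_norm Th M l w.
Proof.
move=> jl; rewrite -[leLHS]ger0_norm ?sqrtr_ge0// -sqrtr_sqr; apply: ler_wsqrtr.
rewrite (bigD1 (Ordinal (jl : j < l.+1)%N))//= lerDl sumr_ge0// => i _.
exact: sqr_ge0.
Qed.

Lemma scaled_seminorm_le mo (Mo : E -> 'M[R]_mo) L s l w (C B : R) :
  graph_norm Om Th M Mo L l w <= B ->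
  C * broken_seminorm Th M s l w <= `|C| * `|B| * mesh_size Th ^+ s.
Proof.
move=> wB; apply: (@le_trans _ _ (`|C| * broken_seminorm Th M s l w)).
  by rewrite ler_wpM2r ?sqrtr_ge0// ler_norm.
rewrite -mulrA ler_wpM2l//; apply: le_trans (broken_seminorm_le _ _ _) _.
rewrite mulrC ler_wpM2r ?exprn_ge0 ?mesh_size_ge0//.
apply: le_trans (broken_seminorm_le_norm w (leqnn l)) _.
apply: le_trans (le_trans wB (ler_norm B)).
by rewrite le_sqrt_addl// addr_ge0 ?sqr_ge0.
Qed.

End BrokenNorms.

(** * Operator norms and step size restrictions *)

(** The restrictions of the step size are given by operator norms, but they are used as
    bounds for the quadratic form q of the operator A. As q is homogeneous, it suffices to
    bound it on the unit ball. *)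
Section OperatorNorm.
Context (R : realType) (d : nat).
Local Notation E := 'rV[R]_d.
Context (Om : set E) (mOm : measurable Om) (m : nat).
Context (M : E -> 'M[R]_m) (hM : is_weight Om M).
Context (V : set (E -> 'cV[R]_m)) (hV : lin_closed V) (VL2 : V `<=` L2 Om (m := m)).
Context (A : (E -> 'cV[R]_m) -> E -> 'cV[R]_m) (AL2 : forall w, V w -> L2 Om (A w)).
Context (q : (E -> 'cV[R]_m) -> R).
Context (qZ : forall c w, V w -> q (c *: w) = c ^+ 2 * q w).
Context (qA : forall w, V w -> q w <= `|ip M Om (A w) w|).
Local Notation opn := (operator_norm Om M V A).

Lemma operator_norm_ge0 : (0 <= opn)%E.
Proof.
apply: le_ereal_sup_tmp; exists (nrm M Om (A 0))%:E; last by rewrite lee_fin nrm_ge0.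
exists 0 => //; split; first by case: hV.
by rewrite /nrm ip0l ?sqrtr0//; exact: L2_0.
Qed.

Lemma quadratic_le_operator_norm (r : R) w : V w -> (opn <= r%:E)%E ->
  q w <= r * nrm M Om w ^+ 2.
Proof.
move=> Vw hr; have Lw := VL2 Vw.
have r0 : 0 <= r by rewrite -lee_fin (le_trans operator_norm_ge0).
have [w0|w0] := eqVneq (nrm M Om w) 0.
  rewrite w0 expr0n mulr0; apply: le_trans (qA Vw) _.
  by apply: le_trans (ip_cauchy_schwarz mOm hM (AL2 Vw) Lw) _; rewrite w0 mulr0.
have wp : 0 < nrm M Om w by rewrite lt_def w0 nrm_ge0.
have VZ c : V (c *: w).
  by rewrite -[c *: w]addr0; case: hV => V0; apply.
pose c := (nrm M Om w)^-1.
have n1 : nrm M Om (c *: w) = 1.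
  by rewrite (nrmZ mOm hM)// ger0_norm ?invr_ge0 ?nrm_ge0// mulVf.
have : q (c *: w) <= r.
  apply: le_trans (qA (VZ c)) _.
  apply: le_trans (ip_cauchy_schwarz mOm hM (AL2 (VZ c)) (VL2 (VZ c))) _.
  rewrite n1 mulr1 -lee_fin; apply: le_trans hr.
  by apply: ereal_sup_ubound; exists (c *: w) => //; split=> //; rewrite n1.
rewrite qZ// /c exprVn mulrC ler_pdivrMr//.
by rewrite exprn_gt0.
Qed.

(** An infinite operator norm would force tau = 0; if the norm vanishes, then so does
    the positive part of q. *)
Lemma cfl_quadratic (tau c : R) w : 0 < tau -> 0 <= c ->
  (tau%:E <= sqrte (c%:E / opn))%E -> V w ->
  tau ^+ 2 * q w <= c * nrm M Om w ^+ 2.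
Proof.
move=> tau0 c0; have := operator_norm_ge0; have := @quadratic_le_operator_norm ^~ w.
case: opn => [r| |] hr r0 ht Vw; last by rewrite leeNy_eq in r0.
  2: by move: ht; rewrite invey mule0/= sqrtr0 lee_fin leNgt tau0.
have qr := hr r Vw (lexx _); move: r0; rewrite lee_fin le_eqVlt => /orP[/eqP r0|r0].
  move: qr; rewrite -r0 mul0r => qr.
  apply: (@le_trans _ _ 0); last by rewrite mulr_ge0 ?sqr_ge0.
  by rewrite pmulr_rle0// exprn_gt0.
move: ht; rewrite inver gt_eqF// -EFinM/= lee_fin => ht.
have : tau ^+ 2 * r <= c.
  rewrite -ler_pdivlMr// -[leRHS]sqr_sqrtr ?divr_ge0 ?(ltW r0)//.
  by rewrite ler_pXn2r ?nnegrE ?sqrtr_ge0// ltW.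
move=> h; apply: (@le_trans _ _ (tau ^+ 2 * (r * nrm M Om w ^+ 2))).
  by rewrite ler_wpM2l ?sqr_ge0.
by rewrite mulrA ler_wpM2r ?sqr_ge0.
Qed.

End OperatorNorm.

(** * Defects of the projected exact solution *)

Section DiscreteOperator.
Context (R : realType) (d : nat).
Local Notation E := 'rV[R]_d.
Context (Om : set E) (hOm : polyhedral Om).
Context (N : nat) (Th : 'I_N -> set E) (hTh : is_mesh Om Th) (k mi mo : nat).
Context (Mi : E -> 'M[R]_mi) (Mo : E -> 'M[R]_mo).
Context (hMi : is_weight Om Mi) (hMo : is_weight Om Mo).
Context (D : set (E -> 'cV[R]_mi)) (L : (E -> 'cV[R]_mi) -> E -> 'cV[R]_mo).
Context (Pi : (E -> 'cV[R]_mi) -> E -> 'cV[R]_mi).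
Context (Po : (E -> 'cV[R]_mo) -> E -> 'cV[R]_mo).
Context (C : R) (Lh : (E -> 'cV[R]_mi) -> E -> 'cV[R]_mo).
Context (D0 : D 0) (DL2 : D `<=` L2 Om (m := mi)) (LL2 : forall w, D w -> L2 Om (L w)).
Context (hPi : orthogonal_projection Om Mi (Vh Om Th k (m := mi)) Pi).
Context (hPo : orthogonal_projection Om Mo (Vh Om Th k (m := mo)) Po).
Context (hLh : dg_operator Om Th k Mi Mo D L Pi Po C Lh).

Let mOm : measurable Om := polyhedral_measurable hOm.

Lemma projectionE m (M : E -> 'M[R]_m) P w z : is_weight Om M ->
  orthogonal_projection Om M (Vh Om Th k (m := m)) P -> L2 Om w ->
  Vh Om Th k z -> ip M Om (P w) z = ip M Om w z.
Proof.
move=> hM hP hw hz; have [VP /(_ _ hz)] := hP w hw.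
have LP := Vh_L2 VP; have Lz := Vh_L2 hz; rewrite ipBl//.
by move/eqP; rewrite subr_eq0 => /eqP.
Qed.

Lemma broken_sobolev0 l m : broken_sobolev Om Th l (0 : E -> 'cV[R]_m).
Proof.
split=> [|K al _]; first exact: L2_0.
exists 0; split=> [|f _ j].
  exact: (L2_0 (polyhedral_measurable (mesh_polyhedral hTh K))).
have h g : \int[leb R d]_(x in Th K) ((0 : E -> 'cV[R]_m) x j ord0 * g x) = 0.
  rewrite (@eq_Rintegral _ _ _ _ _ (cst 0)) => [|x _]; last by rewrite mxE mul0r.
  rewrite Rintegral_cst ?mul0r//.
  exact: (polyhedral_measurable (mesh_polyhedral hTh K)).
by rewrite !h mulr0.
Qed.

Lemma Lh_Vh w : Vh Om Th k w -> Vh Om Th k (Lh w).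
Proof.
move=> Vw; have [h _ _ _] := hLh; apply: h; exists w, 0; split=> //.
  exact: broken_sobolev0.
by rewrite addr0.
Qed.

(** The discrete operator applied to the projection of w agrees with L w up to the
    approximation error rho = Lh (w - Pi w). *)
Lemma consistency w : D w -> broken_sobolev Om Th k.+1 w ->
  exists rho, [/\ Vh Om Th k rho,
    nrm Mo Om rho <= C * broken_seminorm Th Mi k k.+1 w &
    forall z, Vh Om Th k z -> ip Mo Om (Lh (Pi w)) z = ip Mo Om (L w) z - ip Mo Om rho z].
Proof.
move=> Dw bw; have [hV hlin hcons happ] := hLh.
have bw1 : broken_sobolev Om Th 1 w.
  by case: bw => w2 h; split=> // K al al1; apply: h; exact: leq_trans al1 _.
have VP : Vh Om Th k (Pi w) by have [] := hPi (DL2 Dw).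
have b0 := broken_sobolev0 1 mi.
have dP : exists a b, [/\ Vh Om Th k a, D b, broken_sobolev Om Th 1 b & Pi w = a + b].
  by exists (Pi w), 0; split=> //; rewrite addr0.
have dw : exists a b, [/\ Vh Om Th k a, D b, broken_sobolev Om Th 1 b & w = a + b].
  by exists 0, w; split=> //; [exact: Vh_0|rewrite add0r].
have e : w - Pi w = -1 *: Pi w + w by rewrite scaleN1r addrC.
have Vrho : Vh Om Th k (Lh (w - Pi w)).
  apply: hV; exists (-1 *: Pi w), w; split=> //.
  exact: Vh_Z.
exists (Lh (w - Pi w)); split=> // [|z Vz]; first exact: happ.
have Lz := Vh_L2 Vz; have VLw := Vh_L2 (hV _ dw); have VLP := Vh_L2 (hV _ dP).
have VPL : Vh Om Th k (Po (L w)) by have [] := hPo (LL2 Dw).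
rewrite e (ip_aeq mOm hMo _ _ Lz (hlin (-1) _ _ dP dw)); last 2 first.
- by rewrite -e; exact: (Vh_L2 Vrho).
- exact: L2_lin.
rewrite ip_lin// (ip_aeq mOm hMo VLw (Vh_L2 VPL) Lz (hcons _ Dw bw1)).
rewrite projectionE//; last exact: LL2.
by ring.
Qed.

(** One of the two equations of the system, w_t = L z + g; both are of this form. *)
Context (T B r : R) (w : R -> E -> 'cV[R]_mo) (wt : nat -> R -> E -> 'cV[R]_mo).
Context (z : R -> E -> 'cV[R]_mi) (g : R -> E -> 'cV[R]_mo).
Local Notation I := [set t : R | 0 <= t <= T].
Context (hw : Cn_with (nrm Mo Om) I (L2 Om (m := mo)) 3 w wt).
Context (hz : forall t, I t -> D (z t) /\ broken_sobolev Om Th k.+1 (z t)).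
Context (hg : forall t, I t -> L2 Om (g t)).
Context (pde : forall t, I t -> aeq Om (wt 1%N t) (L (z t) + g t)).
Context (hB : forall j t, (j <= 3)%N -> I t -> nrm Mo Om (wt j t) <= B).
Context (hr : forall t, I t -> C * broken_seminorm Th Mi k k.+1 (z t) <= r).
Implicit Types (t tau : R).

Let wL2 j t : (j <= 3)%N -> I t -> L2 Om (wt j t).
Proof. by case: hw => _ h _ _; exact: h. Qed.

Let w0 : wt 0%N = w. Proof. by case: hw. Qed.

Let w_tested y j : (j < 3)%N -> L2 Om y ->
  derivative_on I (fun t => ip Mo Om (wt j t) y) (fun t => ip Mo Om (wt j.+1 t) y).
Proof.
move=> j3 hy; have [_ _ h _] := hw; apply: derivative_on_ip => //.
- by move=> t; apply: wL2; exact: ltnW.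
- by move=> t; exact: wL2.
- exact: h.
Qed.

Let ip_le y f c : L2 Om f -> L2 Om y -> nrm Mo Om f <= c ->
  `|ip Mo Om f y| <= c * nrm Mo Om y.
Proof.
move=> hf hy fc; apply: le_trans (ip_cauchy_schwarz mOm hMo hf hy) _.
by rewrite ler_wpM2r ?nrm_ge0.
Qed.

Lemma discrete_operator_projected t : I t -> exists rho : (E -> 'cV[R]_mo) -> R,
  forall y, Vh Om Th k y -> `|rho y| <= r * nrm Mo Om y /\
    ip Mo Om (Lh (Pi (z t))) y = ip Mo Om (wt 1%N t) y - ip Mo Om (g t) y - rho y.
Proof.
move=> It; have [Dz bz] := hz It.
have [rho [Vrho nrho hrho]] := consistency Dz bz.
exists (fun y => ip Mo Om rho y) => y Vy; have Ly := Vh_L2 Vy; split.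
  by apply: ip_le => //; [exact: (Vh_L2 Vrho)|exact: le_trans (hr It)].
have LLz := LL2 Dz; have Lg := hg It.
rewrite hrho// (ip_aeq mOm hMo (wL2 _ It) _ Ly (pde It))//; last exact: L2D.
by rewrite ipDl// addrK.
Qed.

(** By consistency, Lh (Pi z) + g may be replaced by w_t up to rho, and what remains is the
    error of the trapezoidal rule. *)
Lemma trapezoid_defect t1 t2 tau y : I t1 -> I t2 -> t2 - t1 = tau -> 0 < tau ->
  Vh Om Th k y ->
  `|ip Mo Om (Po (w t2) - Po (w t1)) y
    - tau / 2 * (ip Mo Om (Lh (Pi (z t1))) y + ip Mo Om (Lh (Pi (z t2))) y)
    - tau * ip Mo Om (2^-1 *: (Po (g t2) + Po (g t1))) y|
  <= tau * (B * tau ^+ 2 + r) * nrm Mo Om y.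
Proof.
move=> I1 I2 t12 tau0 Vy; have Ly := Vh_L2 Vy.
have [rho1 /(_ _ Vy)[n1 ->]] := discrete_operator_projected I1.
have [rho2 /(_ _ Vy)[n2 ->]] := discrete_operator_projected I2.
have Lw t : I t -> L2 Om (w t) by rewrite -w0; exact: wL2.
have VPw t : I t -> L2 Om (Po (w t)).
  by move=> It; have [/Vh_L2] := hPo (Lw _ It).
have VPg t : I t -> L2 Om (Po (g t)).
  by move=> It; have [/Vh_L2] := hPo (hg It).
have Pw t : I t -> ip Mo Om (Po (w t)) y = ip Mo Om (w t) y.
  by move=> It; apply: projectionE => //; exact: Lw.
have Pg t : I t -> ip Mo Om (Po (g t)) y = ip Mo Om (g t) y.
  by move=> It; apply: projectionE => //; exact: hg.
have := (VPw _ I1, VPw _ I2, VPg _ I1, VPg _ I2) => -[[[? ?] ?] ?].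
rewrite ipZl ?ipBl ?ipDl ?Pw ?Pg//; try exact: L2D.
have := trapezoid I1 I2 (w_tested (ltn0Sn _) Ly) (w_tested (isT : (1 < 3)%N) Ly)
  (w_tested (isT : (2 < 3)%N) Ly) (B := B * nrm Mo Om y).
rewrite t12 !w0 => trap.
have {}trap := trap (fun t It => ip_le (wL2 (leqnn 3) It) Ly (hB (leqnn 3) It)).
rewrite (ger0_norm (ltW tau0)) in trap.
set X := _ - _ - tau / 2 * (_ + _) in trap.
rewrite [X in `|X|](_ : _ = X + tau / 2 * (rho1 y + rho2 y)); last by rewrite /X; field.
apply: le_trans (ler_normD _ _) _; rewrite normrM (ger0_norm (_ : 0 <= tau / 2)); last first.
  by rewrite divr_ge0// ltW.
have : tau / 2 * `|rho1 y + rho2 y| <= tau / 2 * (r * nrm Mo Om y + r * nrm Mo Om y).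
  rewrite ler_wpM2l ?divr_ge0 ?(ltW tau0)//.
  by apply: le_trans (ler_normD _ _) _; exact: lerD.
move: trap; lra.
Qed.

(** For differences in time of Lh (Pi z), the right-hand side must be differentiable too:
    they are differences of w_t - g up to rho. *)
Context (Bg : R) (gt : nat -> R -> E -> 'cV[R]_mo).
Context (hg2 : Cn_with (nrm Mo Om) I (L2 Om (m := mo)) 2 g gt).
Context (hBg : forall j t, (j <= 2)%N -> I t -> nrm Mo Om (gt j t) <= Bg).

Let gL2 j t : (j <= 2)%N -> I t -> L2 Om (gt j t).
Proof. by case: hg2 => _ h _ _; exact: h. Qed.

Let g0 : gt 0%N = g. Proof. by case: hg2. Qed.

Let g_tested y j : (j < 2)%N -> L2 Om y ->
  derivative_on I (fun t => ip Mo Om (gt j t) y) (fun t => ip Mo Om (gt j.+1 t) y).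
Proof.
move=> j3 hy; have [_ _ h _] := hg2; apply: derivative_on_ip => //.
- by move=> t; apply: gL2; exact: ltnW.
- by move=> t; exact: gL2.
- exact: h.
Qed.

Lemma projected_first_difference t1 t2 tau y : I t1 -> I t2 -> t2 - t1 = tau -> 0 < tau ->
  Vh Om Th k y ->
  `|ip Mo Om (Lh (Pi (z t2))) y - ip Mo Om (Lh (Pi (z t1))) y|
  <= (tau * (B + Bg) + 2 * r) * nrm Mo Om y.
Proof.
move=> I1 I2 t12 tau0 Vy; have Ly := Vh_L2 Vy.
have [rho1 /(_ _ Vy)[n1 ->]] := discrete_operator_projected I1.
have [rho2 /(_ _ Vy)[n2 ->]] := discrete_operator_projected I2.
have h1 := mean_value_dist I1 I2 (w_tested (isT : (1 < 3)%N) Ly)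
  (fun t It _ => ip_le (wL2 (isT : 2 <= 3)%N It) Ly (hB (isT : 2 <= 3)%N It)).
have h2 := mean_value_dist I1 I2 (g_tested (isT : (0 < 2)%N) Ly)
  (fun t It _ => ip_le (gL2 (isT : 1 <= 2)%N It) Ly (hBg (isT : 1 <= 2)%N It)).
rewrite t12 (ger0_norm (ltW tau0)) ?g0 in h1 h2.
move: h1 h2 n1 n2.
set w1 := ip _ _ (wt _ t1) y; set w2 := ip _ _ (wt _ t2) y.
set g1' := ip _ _ (g t1) y; set g2' := ip _ _ (g t2) y => h1 h2 n1 n2.
rewrite [X in `|X|](_ : _ = (w2 - w1) - (g2' - g1') - (rho2 y - rho1 y)); last by ring.
apply: le_trans (ler_normB _ _) _; apply: le_trans (lerD (ler_normB _ _) (ler_normB _ _)) _.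
apply: le_trans (lerD (lerD h1 h2) (lerD n2 n1)) _.
by rewrite le_eqVlt; apply/orP; left; apply/eqP; ring.
Qed.

Lemma projected_second_difference t0 t1 t2 tau y : I t0 -> I t1 -> I t2 ->
  t1 - t0 = tau -> t2 - t1 = tau -> 0 < tau -> Vh Om Th k y ->
  `|(ip Mo Om (Lh (Pi (z t2))) y - ip Mo Om (Lh (Pi (z t1))) y)
    - (ip Mo Om (Lh (Pi (z t1))) y - ip Mo Om (Lh (Pi (z t0))) y)|
  <= (2 * (B + Bg) * tau ^+ 2 + 4 * r) * nrm Mo Om y.
Proof.
move=> I0 I1 I2 t01 t12 tau0 Vy; have Ly := Vh_L2 Vy.
have [rho0 /(_ _ Vy)[n0 ->]] := discrete_operator_projected I0.
have [rho1 /(_ _ Vy)[n1 ->]] := discrete_operator_projected I1.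
have [rho2 /(_ _ Vy)[n2 ->]] := discrete_operator_projected I2.
have e0 : t0 = t1 - tau by lra.
have e2 : t2 = t1 + tau by lra.
rewrite e0 e2 in I0 I2 *.
have h1 := second_difference I0 I1 I2 (w_tested (isT : (1 < 3)%N) Ly) (w_tested (isT : (2 < 3)%N) Ly)
  (fun t It => ip_le (wL2 (isT : 3 <= 3)%N It) Ly (hB (isT : 3 <= 3)%N It)).
have h2 := second_difference I0 I1 I2 (g_tested (isT : (0 < 2)%N) Ly) (g_tested (isT : (1 < 2)%N) Ly)
  (fun t It => ip_le (gL2 (isT : 2 <= 2)%N It) Ly (hBg (isT : 2 <= 2)%N It)).
rewrite ?g0 in h2.
pose D2 (p2 p1 p0 : R) := (p2 - p1) - (p1 - p0).
rewrite -/(D2 _ _ _) in h1; rewrite -/(D2 _ _ _) in h2.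
set w2 := ip _ _ (wt _ (t1 + tau)) y in h1 *; set w1 := ip _ _ (wt _ t1) y in h1 *.
set w0' := ip _ _ (wt _ (t1 - tau)) y in h1 *.
set g2' := ip _ _ (g (t1 + tau)) y in h2 *; set g1' := ip _ _ (g t1) y in h2 *.
set g0' := ip _ _ (g (t1 - tau)) y in h2 *.
rewrite [X in `|X|](_ : _ = D2 w2 w1 w0' - D2 g2' g1' g0' - D2 (rho2 y) (rho1 y) (rho0 y));
  last by rewrite /D2; ring.
apply: le_trans (ler_normB _ _) _; apply: le_trans (lerD (ler_normB _ _) (lexx _)) _.
have : `|D2 (rho2 y) (rho1 y) (rho0 y)| <= 4 * r * nrm Mo Om y.
  apply: le_trans (ler_normB _ _) _; apply: le_trans (lerD (ler_normB _ _) (ler_normB _ _)) _.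
  by apply: le_trans (lerD (lerD n2 n1) (lerD n1 n0)) _; rewrite le_eqVlt; apply/orP; left; apply/eqP; ring.
move/(lerD (lerD h1 h2))/le_trans; apply.
by rewrite le_eqVlt; apply/orP; left; apply/eqP; ring.
Qed.

End DiscreteOperator.

(** * The error bound *)

Lemma Vh_closed (R : realType) d (Om : set 'rV[R]_d) (hOm : polyhedral Om)
    N (Th : 'I_N -> set 'rV[R]_d) k m : lin_closed (Vh Om Th k (m := m)).
Proof. by split=> [|c w z]; [exact: Vh_0|exact: Vh_lin]. Qed.

Section LocalCFL.
Context (R : realType) (d : nat).
Local Notation E := 'rV[R]_d.
Context (Om : set E) (hOm : polyhedral Om).
Context (N : nat) (Th : 'I_N -> set E) (hTh : is_mesh Om Th) (k m_u m_v : nat).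
Context (Mu : E -> 'M[R]_m_u) (Mv : E -> 'M[R]_m_v).
Context (hMu : is_weight Om Mu) (hMv : is_weight Om Mv).
Context (Lu : (E -> 'cV[R]_m_u) -> E -> 'cV[R]_m_v).
Context (Lv : (E -> 'cV[R]_m_v) -> E -> 'cV[R]_m_u).
Context (LuV : forall w, Vh Om Th k w -> Vh Om Th k (Lu w)).
Context (LvV : forall w, Vh Om Th k w -> Vh Om Th k (Lv w)).
Context (adj : forall w z, Vh Om Th k w -> Vh Om Th k z ->
       ip Mv Om (Lu w) z = - ip Mu Om w (Lv z)).
Context (S : {set 'I_N}).

Let mOm : measurable Om := polyhedral_measurable hOm.

Lemma ip_local_operator w z : Vh Om Th k w -> Vh Om Th k z ->
  ip Mu Om (Lv (chi Th S (Lu w))) z = - ip Mv Om (chi Th S (Lu w)) (Lu z).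
Proof.
move=> Vw Vz; have VLw := LuV Vw; have VLz := LuV Vz.
have Vc := chi_Vh hOm hTh S VLw.
rewrite (ipC mOm hMv (Vh_L2 Vc) (Vh_L2 VLz)) adj// opprK.
by rewrite (ipC mOm hMu (Vh_L2 (LvV Vc)) (Vh_L2 Vz)).
Qed.

Lemma local_cfl (tau c : R) : 0 < tau -> 0 <= c ->
  (tau%:E <= sqrte (c%:E / operator_norm Om Mu (Vh Om Th k (m := m_u))
                     (fun w => Lv (chi Th S (Lu w)))))%E ->
  forall w, Vh Om Th k w ->
    tau ^+ 2 * ip Mv Om (chi Th S (Lu w)) (Lu w) <= c * nrm Mu Om w ^+ 2.
Proof.
move=> tau0 c0 ht w Vw.
pose q w := ip Mv Om (chi Th S (Lu w)) (Lu w).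
have VL2 : Vh Om Th k (m := m_u) `<=` L2 Om (m := m_u) by move=> ? /Vh_L2.
have AV x : Vh Om Th k x -> Vh Om Th k (Lv (chi Th S (Lu x))).
  by move=> Vx; apply/LvV/chi_Vh => //; exact: LuV.
apply: (cfl_quadratic (A := fun w => Lv (chi Th S (Lu w))) (q := q) mOm hMu
  (Vh_closed hOm Th k m_u) VL2 _ _ _ tau0 c0 ht Vw) => [x Vx|a x Vx|x Vx].
- exact: Vh_L2 (AV _ Vx).
- have Vax := Vh_Z hOm a Vx.
  have VL := LuV Vx; have VLa := LuV Vax.
  have hom z : Vh Om Th k z -> ip Mv Om (Lu (a *: x)) z = a * ip Mv Om (Lu x) z.
    move=> Vz; rewrite !adj// (ipZl mOm hMu) ?mulrN//; first exact: Vh_L2 Vx.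
    exact: Vh_L2 (LvV Vz).
  have Vc := chi_Vh hOm hTh S VL; have Vca := chi_Vh hOm hTh S VLa.
  rewrite /q ip_chi_sym hom// -ip_chi_sym (ipC mOm hMv (Vh_L2 Vc) (Vh_L2 VLa)) hom//.
  by rewrite -ip_chi_sym mulrA.
- by rewrite /q ip_local_operator// normrN ler_norm.
Qed.

End LocalCFL.

(** The hypothesis on c says that z obeys the step size restriction, which places z in
    [0, beta^2], where the filter is controlled. At z = 0 the last bound
    holds because Theta 0 = 1. *)
Lemma filter_at_eigenvalue (R : realType) (Psi : R -> R) (cT C tau : R)
    (beta opn : \bar R) (z : R) :
  Psi 0 = 1 -> is_beta Psi cT beta -> phi_bound Psi beta C -> 0 <= z ->
  (forall c, 0 <= c -> (tau%:E <= sqrte (c%:E / opn))%E -> z <= c) ->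
  (tau%:E <= tau_CFL_Psi beta opn)%E ->
  [/\ 0 < Psi z, cT <= (Psi z)^-1 - z / 4 & `|(Psi z)^-1 - z / 4 - 1| <= C * z].
Proof.
move=> Psi0 [beta0 hb _] hC z0 hcfl ht.
have zb : (z%:E <= beta ^+ 2)%E.
  move: beta0 ht; rewrite /tau_CFL_Psi; case: beta {hb hC} => [b| |] b0 ht; last by [].
  2: by rewrite expe2 mulyy leey.
  by rewrite -EFin_expe lee_fin; apply: hcfl; rewrite ?sqr_ge0// EFin_expe.
have [p0 [_ hT]] := hb z z0 zb; split=> //.
have := hC z z0 zb; rewrite /phi /Theta.
have [->|zn0] := eqVneq z 0; first by rewrite Psi0 invr1 mul0r subr0 subrr normr0 mulr0.
have zp : 0 < z by rewrite lt_def zn0.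
by rewrite normrM normfV (ger0_norm z0) ler_pdivrMr.
Qed.

Lemma nrm2_le (R : realType) d m_u m_v (Mu : 'rV[R]_d -> 'M[R]_m_u) (Mv : 'rV[R]_d -> 'M[R]_m_v)
  K u v : nrm2 Mu Mv K u v <= nrm Mu K u + nrm Mv K v.
Proof.
have h1 : 0 <= nrm Mu K u := sqrtr_ge0 _.
have h2 : 0 <= nrm Mv K v := sqrtr_ge0 _.
rewrite -[leRHS]ger0_norm ?addr_ge0// -sqrtr_sqr ler_wsqrtr//.
rewrite sqrrD; have := mulr_ge0 h1 h2; lra.
Qed.

Lemma ip_half_step (R : realType) d (Om : set 'rV[R]_d) m (M : 'rV[R]_d -> 'M[R]_m)
    (mOm : measurable Om) (hM : is_weight Om M) (p : R) x y f g z :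
  L2 Om x -> L2 Om y -> L2 Om f -> L2 Om g -> L2 Om z ->
  aeq Om (x - y) (p *: f + p *: g) ->
  ip M Om (x - y) z = p * ip M Om f z + p * ip M Om g z.
Proof.
move=> hx hy hf hg hz e.
have hpf := L2Z mOm p hf; have hpg := L2Z mOm p hg.
have hxy := L2B mOm hx hy; have hfg := L2D mOm hpf hpg.
by rewrite (ip_aeq mOm hM hxy hfg hz e) (ipDl mOm hM)// !(ipZl mOm hM).
Qed.

Theorem theorem3p14 (R : realType) (d : nat) (hd : (0 < d)%N)
    (Om : set 'rV[R]_d) (hOm : polyhedral Om)
    (T : R) (hT : 0 < T) (k : nat)
    (cTheta theta Cphi Cpi CpiL : R)
    (hcTheta : 0 < cTheta <= 1) (htheta : 0 < theta < 1)
    (* bounds for the norms of x and g_v *)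
    (B0 B3 Bg : R) :
  exists C : R,
  forall
    (* continuous problem *)
    (m_u m_v : nat)
    (Mu : 'rV[R]_d -> 'M[R]_m_u) (Mv : 'rV[R]_d -> 'M[R]_m_v)
    (hMu : is_weight Om Mu) (hMv : is_weight Om Mv)
    (A : 'I_d -> 'M[R]_(m_v, m_u))
    (Du : set ('rV[R]_d -> 'cV[R]_m_u)) (Dv : set ('rV[R]_d -> 'cV[R]_m_v))
    (Lu : ('rV[R]_d -> 'cV[R]_m_u) -> 'rV[R]_d -> 'cV[R]_m_v)
    (Lv : ('rV[R]_d -> 'cV[R]_m_v) -> 'rV[R]_d -> 'cV[R]_m_u)
    (hLu : friedrichs_operator Om Mv A Du Lu)
    (hLv : friedrichs_operator Om Mu (fun i => (A i)^T) Dv Lv)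
    (hLadj : forall w z, Du w -> Dv z -> ip Mv Om (Lu w) z = - ip Mu Om w (Lv z))
    (* mesh and its splitting *)
    (N : nat) (Th : 'I_N -> set 'rV[R]_d) (hTh : is_mesh Om Th)
    (fine : {set 'I_N})
    (* projections and discrete operators *)
    (pu : ('rV[R]_d -> 'cV[R]_m_u) -> 'rV[R]_d -> 'cV[R]_m_u)
    (pv : ('rV[R]_d -> 'cV[R]_m_v) -> 'rV[R]_d -> 'cV[R]_m_v)
    (hpu : orthogonal_projection Om Mu (Vh Om Th k (m := m_u)) pu)
    (hpv : orthogonal_projection Om Mv (Vh Om Th k (m := m_v)) pv)
    (hpu_approx : forall w, broken_sobolev Om Th k.+1 w ->
       nrm Mu Om (w - pu w) <= Cpi * broken_seminorm Th Mu k.+1 k.+1 w)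
    (hpv_approx : forall w, broken_sobolev Om Th k.+1 w ->
       nrm Mv Om (w - pv w) <= Cpi * broken_seminorm Th Mv k.+1 k.+1 w)
    (Luh : ('rV[R]_d -> 'cV[R]_m_u) -> 'rV[R]_d -> 'cV[R]_m_v)
    (Lvh : ('rV[R]_d -> 'cV[R]_m_v) -> 'rV[R]_d -> 'cV[R]_m_u)
    (hLuh : dg_operator Om Th k Mu Mv Du Lu pu pv CpiL Luh)
    (hLvh : dg_operator Om Th k Mv Mu Dv Lv pv pu CpiL Lvh)
    (hLhadj : forall w z, Vh Om Th k w -> Vh Om Th k z ->
       ip Mv Om (Luh w) z = - ip Mu Om w (Lvh z))
    (* filter function *)
    (Psi : R -> R) (hPsi : smooth_on_nonneg Psi) (hPsi0 : Psi 0 = 1)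
    (beta : \bar R) (hbeta : is_beta Psi cTheta beta)
    (hCphi : is_Cphi Psi beta Cphi)
    (* data and solution: ut j and vt j are the j-th time derivatives *)
    (u0 : 'rV[R]_d -> 'cV[R]_m_u) (v0 : 'rV[R]_d -> 'cV[R]_m_v)
    (gu : R -> 'rV[R]_d -> 'cV[R]_m_u) (gv : R -> 'rV[R]_d -> 'cV[R]_m_v)
    (gvt : nat -> R -> 'rV[R]_d -> 'cV[R]_m_v)
    (u : R -> 'rV[R]_d -> 'cV[R]_m_u) (v : R -> 'rV[R]_d -> 'cV[R]_m_v)
    (ut : nat -> R -> 'rV[R]_d -> 'cV[R]_m_u)
    (vt : nat -> R -> 'rV[R]_d -> 'cV[R]_m_v),
  let I := [set t : R | 0 <= t <= T] in
  forall
    (hgu : forall t, I t -> L2 Om (gu t))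
    (hgv : Cn_with (nrm Mv Om) I (L2 Om (m := m_v)) 2 gv gvt)
    (hu3 : Cn_with (nrm Mu Om) I (L2 Om (m := m_u)) 3 u ut)
    (hv3 : Cn_with (nrm Mv Om) I (L2 Om (m := m_v)) 3 v vt)
    (huD : forall t, I t -> Du (u t) /\ broken_sobolev Om Th k.+1 (u t))
    (hvD : forall t, I t -> Dv (v t) /\ broken_sobolev Om Th k.+1 (v t))
    (huc : continuous_in (graph_norm Om Th Mu Mv Lu k.+1) I u)
    (hvc : continuous_in (graph_norm Om Th Mv Mu Lv k.+1) I v)
    (hpde_u : forall t, I t -> aeq Om (ut 1%N t) (Lv (v t) + gu t))
    (hpde_v : forall t, I t -> aeq Om (vt 1%N t) (Lu (u t) + gv t))
    (hu0 : aeq Om (u 0) u0) (hv0 : aeq Om (v 0) v0)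
    (hB0 : forall t, I t ->
       Num.sqrt (graph_norm Om Th Mu Mv Lu k.+1 (u t) ^+ 2 +
                 graph_norm Om Th Mv Mu Lv k.+1 (v t) ^+ 2) <= B0)
    (hB3 : forall j t, (j <= 3)%N -> I t -> nrm2 Mu Mv Om (ut j t) (vt j t) <= B3)
    (hBg : forall j t, (j <= 2)%N -> I t -> nrm Mv Om (gvt j t) <= Bg)
    (* time step *)
    (tau : R),
  let L_m w := Lvh (chi Th (mesh_m Th fine) (Luh w)) in
  let L_lf w := Lvh (chi Th (mesh_lf Th fine) (Luh w)) in
  let opn := operator_norm Om Mu (Vh Om Th k (m := m_u)) in
  forall
    (htau0 : 0 < tau)
    (htau : (tau%:E <= Order.min (tau_CFL_lf cTheta theta (opn L_lf))
                                 (tau_CFL_Psi beta (opn L_m)))%E)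
    (* the operator Psi(- tau^2 L_{v,h} chi_m L_{u,h}) *)
    (bPsi : ('rV[R]_d -> 'cV[R]_m_u) -> 'rV[R]_d -> 'cV[R]_m_u)
    (hbPsi : functional_calculus Om Mu (Vh Om Th k (m := m_u)) Psi
       (fun w => - tau ^+ 2 *: L_m w) bPsi)
    (* numerical approximations; vb n is \overline v_h^{n+1/2} *)
    (uh : nat -> 'rV[R]_d -> 'cV[R]_m_u)
    (vh vb : nat -> 'rV[R]_d -> 'cV[R]_m_v),
  let t (n : nat) : R := n%:R * tau in
  let guh n := 2^-1 *: (pu (gu (t n.+1)) + pu (gu (t n))) in
  let gvh n := 2^-1 *: (pv (gv (t n.+1)) + pv (gv (t n))) in
  forall
    (huh : forall n, t n <= T -> Vh Om Th k (uh n))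
    (hvh : forall n, t n <= T -> Vh Om Th k (vh n))
    (hvb : forall n, t n.+1 <= T -> Vh Om Th k (vb n))
    (hinit_u : aeq Om (uh 0%N) (pu (u 0)))
    (hinit_v : aeq Om (vh 0%N) (pv (v 0)))
    (hscheme1 : forall n, t n.+1 <= T ->
       aeq Om (vb n - vh n) ((tau / 2) *: Luh (uh n) + (tau / 2) *: gvh n))
    (hscheme2 : forall n, t n.+1 <= T ->
       aeq Om (uh n.+1 - uh n) (tau *: bPsi (Lvh (vb n) + guh n)))
    (hscheme3 : forall n, t n.+1 <= T ->
       aeq Om (vh n.+1 - vb n)
         ((tau / 2) *: Luh (uh n.+1) + (tau / 2) *: gvh n)),
  forall n : nat, t n.+1 <= T ->
    nrm2 Mu Mv Om (u (t n.+1) - uh n.+1) (v (t n.+1) - vh n.+1)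
      <= C * (tau ^+ 2 + mesh_size Th ^+ k).
Proof.
have dominate (x y s q : R) : 0 <= x -> 0 <= y -> 0 <= s -> 0 <= q ->
    x * s + y * q <= (x + y) * (s + q).
  move=> x0 y0 s0 q0; rewrite mulrDl !mulrDr.
  by have := mulr_ge0 x0 q0; have := mulr_ge0 y0 s0; lra.
have dominateT (x y s q : R) : s <= T -> 0 <= y -> 0 <= q ->
    s * (s * x + 2 * (y * q)) <= x * s ^+ 2 + (2 * T * y) * q.
  move=> sT y0 q0; have : s * (y * q) <= T * (y * q) by rewrite ler_wpM2r// mulr_ge0.
  lra.
have [Dm Dm0 hDm] := diameter_bound hOm.
(* rr h^k bounds the consistency errors; c1, c2 and c3 are the constants in the bounds for the
   defects and for the first and second differences in time. *)
pose rr := `|CpiL| * `|B0|.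
pose c1 := `|B3| + rr.
pose c2 := `|B3| + `|Bg| + 2 * T * rr.
pose c3 := 2 * (`|B3| + `|Bg|) + 4 * rr.
pose Cq := `|Cphi| + 1.
pose C0 := 2 * ((2 * (Cq * c2) + 4 * T * c1 + 2 * T * (Cq * c3) + 2 * T * c1 * (Cq * c2))
              / (cTheta * (1 - theta ^+ 2)) + 1).
exists (2 * (`|Cpi| * Dm * `|B0|) + C0).
move=> m_u m_v Mu Mv hMu hMv A Du Dv Lu Lv hLu hLv _ N Th hTh fine pu pv hpu hpv
  hpua hpva Luh Lvh hLuh hLvh hadj Psi _ hPsi0 beta hbeta [hphi _] u0 v0 gu gv gvt u v ut vt
  I hgu hgv hu3 hv3 huD hvD _ _ pdeu pdev _ _ hB0 hB3 hBg tau L_m L_lf opn tau0 htau bPsi hbPsi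
  uh vh vb t guh gvh huh hvh hvb hiu hiv hs1 hs2 hs3 n hn.
have mOm : measurable Om := polyhedral_measurable hOm.
pose h := mesh_size Th; have h0 : 0 <= h := mesh_size_ge0 Th.
have hD : h <= Dm.
  apply: mesh_size_le => // K; have [ne _ _ _ _] := mesh_polyhedral hTh K.
  by have /andP[] := hDm _ ne (mesh_sub hOm hTh (K := K)).
pose delta := tau ^+ 2 + h ^+ k.
have hk0 : 0 <= h ^+ k by exact: exprn_ge0.
have delta0 : 0 <= delta by rewrite addr_ge0 ?sqr_ge0.
have It m : (m <= n.+1)%N -> I (t m).
  move=> mn; rewrite /I/= /t mulr_ge0 ?(ltW tau0)//=; apply: le_trans hn.
  by rewrite /t ler_wpM2r ?(ltW tau0)// ler_nat.
have tT m : (m <= n.+1)%N -> t m <= T by move/It => /andP[].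
have tS m : t m.+1 - t m = tau by rewrite /t -mulrBl -natrB// subSnn mul1r.
have rr0 : 0 <= rr by rewrite mulr_ge0.
have tauT : tau <= T.
  apply: le_trans (tT n.+1 (leqnn _)); rewrite /t ler_peMl ?(ltW tau0)//.
  by rewrite ler1n.
have [_ [Du0 _] _ _] := hLu; have [_ [Dv0 _] _ _] := hLv.
have DuL2 : Du `<=` L2 Om (m := m_u) by case: hLu.
have DvL2 : Dv `<=` L2 Om (m := m_v) by case: hLv.
have LuL2 w : Du w -> L2 Om (Lu w) by case: hLu => _ _ _ hh /hh[].
have LvL2 w : Dv w -> L2 Om (Lv w) by case: hLv => _ _ _ hh /hh[].
have gvL2 s : I s -> L2 Om (gv s) by case: hgv => <- hh _ _; exact: hh.
have LuV w : Vh Om Th k w -> Vh Om Th k (Luh w) by exact: (Lh_Vh hOm hTh Du0 hLuh).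
have LvV w : Vh Om Th k w -> Vh Om Th k (Lvh w) by exact: (Lh_Vh hOm hTh Dv0 hLvh).
(* The bounds of the continuous problem dominate consistency and projection errors. *)
have graph_u s : I s -> graph_norm Om Th Mu Mv Lu k.+1 (u s) <= B0.
  by move=> Is; apply: le_trans (hB0 s Is); rewrite addrC le_sqrt_addl ?sqr_ge0.
have graph_v s : I s -> graph_norm Om Th Mv Mu Lv k.+1 (v s) <= B0.
  by move=> Is; apply: le_trans (hB0 s Is); rewrite le_sqrt_addl ?sqr_ge0.
have cru s : I s -> CpiL * broken_seminorm Th Mu k k.+1 (u s) <= rr * h ^+ k.
  by move=> Is; exact: (scaled_seminorm_le hOm hTh hMu k CpiL (graph_u s Is)).
have crv s : I s -> CpiL * broken_seminorm Th Mv k k.+1 (v s) <= rr * h ^+ k.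
  by move=> Is; exact: (scaled_seminorm_le hOm hTh hMv k CpiL (graph_v s Is)).
have hk1 : `|Cpi| * `|B0| * h ^+ k.+1 <= `|Cpi| * Dm * `|B0| * delta.
  rewrite exprS (mulrAC _ Dm) -!(mulrA (_ * _)) ler_wpM2l ?mulr_ge0//.
  by apply: ler_pM => //; rewrite lerDr sqr_ge0.
have Pu s : I s -> nrm Mu Om (u s - pu (u s)) <= `|Cpi| * Dm * `|B0| * delta.
  move=> Is; apply: le_trans (hpua (u s) (huD s Is).2) _; apply: le_trans hk1.
  exact: (scaled_seminorm_le hOm hTh hMu k.+1 Cpi (graph_u s Is)).
have Pv s : I s -> nrm Mv Om (v s - pv (v s)) <= `|Cpi| * Dm * `|B0| * delta.
  move=> Is; apply: le_trans (hpva (v s) (hvD s Is).2) _; apply: le_trans hk1.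
  exact: (scaled_seminorm_le hOm hTh hMv k.+1 Cpi (graph_v s Is)).
have Bu j s : (j <= 3)%N -> I s -> nrm Mu Om (ut j s) <= `|B3|.
  move=> j3 Is; apply: le_trans (ler_norm _); apply: le_trans (hB3 j s j3 Is).
  by rewrite /nrm2 addrC le_sqrt_addl ?sqr_ge0.
have Bv j s : (j <= 3)%N -> I s -> nrm Mv Om (vt j s) <= `|B3|.
  move=> j3 Is; apply: le_trans (ler_norm _); apply: le_trans (hB3 j s j3 Is).
  by rewrite /nrm2 le_sqrt_addl ?sqr_ge0.
have Bgv j s : (j <= 2)%N -> I s -> nrm Mv Om (gvt j s) <= `|Bg|.
  by move=> j2 Is; apply: le_trans (ler_norm _); exact: hBg.
(* The discrete spaces as modules, so that the abstract result applies. *)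
have hVu := Vh_closed hOm Th k m_u; have hVv := Vh_closed hOm Th k m_v.
pose U := submod hVu; pose V := submod hVv.
pose a (x y : U) := ip Mu Om (val x) (val y).
pose b (x y : V) := ip Mv Om (val x) (val y).
have ha : semi_inner a by apply: ip_semi_inner => // x /Vh_L2.
have hb : semi_inner b by apply: ip_semi_inner => // x /Vh_L2.
pose L (x : U) : V := to_submod hVv (Luh (val x)).
pose L' (x : V) : U := to_submod hVu (Lvh (val x)).
pose P (x : V) : V := to_submod hVv (chi Th (mesh_m Th fine) (val x)).
have Lval x : val (L x) = Luh (val x) by rewrite to_submodK//; apply: LuV; exact: submodP.
have L'val x : val (L' x) = Lvh (val x) by rewrite to_submodK//; apply: LvV; exact: submodP.
have Pval x : val (P x) = chi Th (mesh_m Th fine) (val x).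
  by rewrite to_submodK//; apply: chi_Vh => //; exact: submodP.
have adj x z : b (L x) z = - a x (L' z).
  by rewrite /a /b Lval L'val hadj//; exact: submodP.
have Psa z z' : b (P z) z' = b z (P z') by rewrite /b !Pval ip_chi_sym.
have Pid z z' : b (P z) (P z') = b (P z) z' by rewrite /b !Pval ip_chi_idem.
have Vval (x : V) : Vh Om Th k (val x) by exact: submodP.
have Uval (x : U) : Vh Om Th k (val x) by exact: submodP.
have cfl_lf x : tau ^+ 2 * (b (L x) (L x) - b (P (L x)) (L x)) <= 4 * cTheta * theta ^+ 2 * a x x.
  have Lx := Vh_L2 (Vval (L x)).
  rewrite /b Pval -(ip_chi_compl hOm hTh hMv _ Lx Lx) Lval /a -(nrmE mOm hMu (Vh_L2 (Uval x))).
  apply: (local_cfl hOm hTh hMu hMv LuV LvV hadj (S := ~: mesh_m Th fine)) => //.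
    by rewrite mulr_ge0 ?sqr_ge0// mulr_ge0//; case/andP: hcTheta => /ltW.
  by apply: (le_trans htau); rewrite ge_min lexx.
(* The filter acts on an orthonormal basis of eigenvectors of the local operator. *)
have [n0 [e [lam [eV eON eA eexp eF]]]] := hbPsi.
pose e' i : U := to_submod hVu (e i).
have e'val i : val (e' i) = e i by rewrite to_submodK.
have eON' i j : a (e' i) (e' j) = (i == j)%:R by rewrite /a !e'val eON.
have sum_val (c : 'I_n0 -> R) : val (\sum_i c i *: e' i) = \sum_i c i *: e i.
  rewrite (raddf_sum (val : U -> _)); apply: eq_bigr => i _; rewrite -e'val.
  exact: linearZ.
have eE w z : a w z = \sum_i a w (e' i) * a z (e' i).
  have Vw := Uval w; have Vz := Uval z.
  transitivity (a (\sum_i a w (e' i) *: e' i) z).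
    have LS := Vh_L2 (Uval (\sum_i a w (e' i) *: e' i)).
    rewrite /a; apply: (ip_aeq mOm hMu (Vh_L2 Vw) LS (Vh_L2 Vz)).
    rewrite sum_val; under eq_bigr do rewrite /a e'val; exact: eexp.
  rewrite (si_suml ha); apply: eq_bigr => i _.
  by rewrite (siZl ha) (siC ha (e' i)).
have eig i w : tau ^+ 2 * b (P (L (e' i))) (L w) = lam i * a (e' i) w.
  rewrite /b Pval !Lval e'val.
  have Vw := Uval w; have VA : Vh Om Th k (L_m (e i)).
    by apply: LvV; apply: chi_Vh => //; exact: LuV.
  have := ip_local_operator hOm hTh hMu hMv LuV LvV hadj (mesh_m Th fine) (eV i) Vw.
  rewrite -[Lvh _]/(L_m (e i)) => ipA.
  rewrite /a e'val -(ipZl mOm hMu _ (Vh_L2 (eV i)) (Vh_L2 Vw)).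
  rewrite -(ip_aeq mOm hMu _ _ (Vh_L2 Vw) (eA i)).
  - by rewrite (ipZl mOm hMu _ (Vh_L2 VA) (Vh_L2 Vw)) ipA; ring.
  - by apply: L2Z => //; exact: Vh_L2 VA.
  - by apply: L2Z => //; exact: Vh_L2 (eV i).
have lamE i : lam i = tau ^+ 2 * ip Mv Om (chi Th (mesh_m Th fine) (Luh (e i))) (Luh (e i)).
  by have := eig i (e' i); rewrite eON' eqxx mulr1 /b Pval !Lval e'val.
have lam0 i : 0 <= lam i := eigenvalue_ge0 hb Pid eON' eig i.
have filt i := filter_at_eigenvalue (z := lam i) (opn := opn L_m) (tau := tau) hPsi0 hbeta hphi (lam0 i).
have {}filt i : [/\ 0 < Psi (lam i), cTheta <= (Psi (lam i))^-1 - lam i / 4 &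
    `|(Psi (lam i))^-1 - lam i / 4 - 1| <= `|Cphi| * lam i].
  have [] := filt i.
  - move=> c c_ge0 hc; rewrite lamE.
    have := local_cfl hOm hTh hMu hMv LuV LvV hadj tau0 c_ge0 hc (eV i).
    by rewrite (nrmE mOm hMu (Vh_L2 (eV i))) eON eqxx mulr1.
  - by apply: (le_trans htau); rewrite ge_min lexx orbT.
  move=> f1 f2 f3; split=> //; apply: le_trans f3 _.
  by rewrite ler_wpM2r// ler_norm.
have Vpu f : L2 Om f -> Vh Om Th k (pu f) by move=> /hpu[].
have Vpv f : L2 Om f -> Vh Om Th k (pv f) by move=> /hpv[].
have uL2 s : I s -> L2 Om (u s) by move=> /huD[/DuL2].
have vL2 s : I s -> L2 Om (v s) by move=> /hvD[/DvL2].
have Vguh m : (m <= n)%N -> Vh Om Th k (guh m).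
  by move=> mn; apply: Vh_Z => //; apply: Vh_D => //; apply: Vpu => //;
     apply: hgu; apply: It => //; exact: leqW.
have Vgvh m : (m <= n)%N -> Vh Om Th k (gvh m).
  by move=> mn; apply: Vh_Z => //; apply: Vh_D => //; apply: Vpv => //;
     apply: gvL2; apply: It => //; exact: leqW.
pose toU := to_submod hVu; pose toV := to_submod hVv.
have toUE w : Vh Om Th k w -> val (toU w) = w by exact: to_submodK.
have toVE w : Vh Om Th k w -> val (toV w) = w by exact: to_submodK.
have uhV m : (m <= n.+1)%N -> Vh Om Th k (uh m) by move=> mn; exact/huh/tT.
have vhV m : (m <= n.+1)%N -> Vh Om Th k (vh m) by move=> mn; exact/hvh/tT.
have vbV m : (m <= n)%N -> Vh Om Th k (vb m) by move=> mn; exact/hvb/(tT m.+1).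
have scheme1 m z : (m <= n)%N -> b (toV (vb m) - toV (vh m)) z =
    tau / 2 * b (L (toU (uh m))) z + tau / 2 * b (toV (gvh m)) z.
  move=> mn; have Vz := Vh_L2 (Vval z).
  have V1 := vbV m mn; have V2 := vhV m (leqW mn); have V3 := uhV m (leqW mn).
  have V4 := LuV _ V3; have V5 := Vgvh m mn.
  rewrite /b Lval raddfB/= !toVE// toUE//.
  exact: (ip_half_step mOm hMv (Vh_L2 V1) (Vh_L2 V2) (Vh_L2 V4) (Vh_L2 V5) Vz (hs1 m (tT m.+1 mn))).
have scheme3 m z : (m <= n)%N -> b (toV (vh m.+1) - toV (vb m)) z =
    tau / 2 * b (L (toU (uh m.+1))) z + tau / 2 * b (toV (gvh m)) z.
  move=> mn; have Vz := Vh_L2 (Vval z).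
  have V1 := vbV m mn; have V2 := vhV m.+1 mn; have V3 := uhV m.+1 mn.
  have V4 := LuV _ V3; have V5 := Vgvh m mn.
  rewrite /b Lval raddfB/= !toVE// toUE//.
  exact: (ip_half_step mOm hMv (Vh_L2 V2) (Vh_L2 V1) (Vh_L2 V4) (Vh_L2 V5) Vz (hs3 m (tT m.+1 mn))).
have scheme2 m w : (m <= n)%N -> a (toU (uh m.+1) - toU (uh m)) w =
    tau * \sum_i Psi (lam i) * a (L' (toV (vb m)) + toU (guh m)) (e' i) * a (e' i) w.
  move=> mn; have Vw := Vh_L2 (Uval w).
  have V1 := uhV m.+1 mn; have V2 := uhV m (leqW mn); have V3 := vbV m mn.
  have V4 := LvV _ V3; have V5 := Vguh m mn.
  have VF := Vh_D hOm V4 V5.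
  have VS : Vh Om Th k (\sum_i (Psi (lam i) * ip Mu Om (Lvh (vb m) + guh m) (e i)) *: e i).
    by rewrite -sum_val; exact: Uval.
  set F := Lvh (vb m) + guh m in VF VS *.
  set S := \sum_i _ in VS.
  (* The value of bPsi need not be measurable, so that it is replaced by the spectral sum
     before the inner product is taken. *)
  have e2 : aeq Om (uh m.+1 - uh m) (tau *: S).
    apply: filterS2 (hs2 m (tT m.+1 mn)) (eF F VF) => x h1 h2 Ox.
    by rewrite h1// /GRing.scale/= h2.
  have FE : val (L' (toV (vb m)) + toU (guh m)) = F by rewrite raddfD/= L'val toVE// toUE.
  have -> : a (toU (uh m.+1) - toU (uh m)) w = ip Mu Om (uh m.+1 - uh m) (val w).
    by rewrite /a raddfB/= !toUE.
  rewrite (ip_aeq mOm hMu _ _ Vw e2); last 2 first.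
  - exact: L2B (Vh_L2 V1) (Vh_L2 V2).
  - exact: L2Z (Vh_L2 VS).
  rewrite (ipZl mOm hMu _ (Vh_L2 VS) Vw); congr (_ * _).
  have -> : S = val (\sum_i (Psi (lam i) * ip Mu Om F (e i)) *: e' i) by rewrite sum_val.
  rewrite -/(a _ w) (si_suml ha); apply: eq_bigr => i _.
  by rewrite (siZl ha) /a FE e'val.
have t0 : t 0%N = 0 by rewrite /t mul0r.
have I0 : I 0 by rewrite /I/= lexx ltW.
have Vpuu s : I s -> Vh Om Th k (pu (u s)) by move=> Is; exact/Vpu/uL2.
have Vpvv s : I s -> Vh Om Th k (pv (v s)) by move=> Is; exact/Vpv/vL2.
have aB x y w : Vh Om Th k x -> Vh Om Th k y ->
    a (toU x - toU y) w = ip Mu Om (x - y) (val w).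
  by move=> Vx Vy; rewrite /a raddfB/= !toUE.
have bB x y w : Vh Om Th k x -> Vh Om Th k y ->
    b (toV x - toV y) w = ip Mv Om (x - y) (val w).
  by move=> Vx Vy; rewrite /b raddfB/= !toVE.
have init_u w : a (toU (pu (u (t 0%N))) - toU (uh 0%N)) w = 0.
  have V1 := Vh_L2 (Vpuu _ I0); have V2 := uhV 0%N isT; have Vw := Vh_L2 (Uval w).
  rewrite t0 aB//; last exact: Vpuu.
  by rewrite (ipBl mOm hMu)//; [rewrite (ip_aeq mOm hMu (Vh_L2 V2) V1 Vw hiu) subrr|exact: Vh_L2 V2].
have init_v w : b (toV (pv (v (t 0%N))) - toV (vh 0%N)) w = 0.
  have V1 := Vh_L2 (Vpvv _ I0); have V2 := vhV 0%N isT; have Vw := Vh_L2 (Vval w).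
  rewrite t0 bB//; last exact: Vpvv.
  by rewrite (ipBl mOm hMv)//; [rewrite (ip_aeq mOm hMv (Vh_L2 V2) V1 Vw hiv) subrr|exact: Vh_L2 V2].
have bL s z : I s -> b (L (toU (pu (u s)))) z = ip Mv Om (Luh (pu (u s))) (val z).
  by move=> Is; rewrite /b Lval toUE//; exact: Vpuu.
have aL' s w : I s -> a (L' (toV (pv (v s)))) w = ip Mu Om (Lvh (pv (v s))) (val w).
  by move=> Is; rewrite /a L'val toVE//; exact: Vpvv.
have tau2 : 0 <= tau ^+ 2 by rewrite sqr_ge0.
have defect_u m w : (m <= n)%N ->
    `|a (toU (pu (u (t m.+1))) - toU (pu (u (t m)))) w
      - tau / 2 * (a (L' (toV (pv (v (t m))))) w + a (L' (toV (pv (v (t m.+1))))) w)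
      - tau * a (toU (guh m)) w| <= tau * c1 * delta * snorm a w.
  move=> mn; have I1 := It m (leqW mn); have I2 := It m.+1 mn.
  have := trapezoid_defect hOm hTh hMu Dv0 DvL2 LvL2 hpv hpu hLvh hu3 hvD hgu pdeu Bu crv
    I1 I2 (tS m) tau0 (Uval w).
  rewrite aB ?aL'//; try exact: Vpuu.
  have -> : a (toU (guh m)) w = ip Mu Om (guh m) (val w) by rewrite /a toUE//; exact: Vguh.
  move/le_trans; apply; rewrite ler_wpM2r ?sqrtr_ge0// -mulrA ler_wpM2l ?(ltW tau0)//.
  exact: dominate.
have defect_v m z : (m <= n)%N ->
    `|b (toV (pv (v (t m.+1))) - toV (pv (v (t m)))) z
      - tau / 2 * (b (L (toU (pu (u (t m))))) z + b (L (toU (pu (u (t m.+1))))) z)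
      - tau * b (toV (gvh m)) z| <= tau * c1 * delta * snorm b z.
  move=> mn; have I1 := It m (leqW mn); have I2 := It m.+1 mn.
  have := trapezoid_defect hOm hTh hMv Du0 DuL2 LuL2 hpu hpv hLuh hv3 huD gvL2 pdev Bv cru
    I1 I2 (tS m) tau0 (Vval z).
  rewrite bB ?bL//; try exact: Vpvv.
  have -> : b (toV (gvh m)) z = ip Mv Om (gvh m) (val z) by rewrite /b toVE//; exact: Vgvh.
  move/le_trans; apply; rewrite ler_wpM2r ?sqrtr_ge0// -mulrA ler_wpM2l ?(ltW tau0)//.
  exact: dominate.
have diff1 m z : (m <= n)%N ->
    tau * `|b (L (toU (pu (u (t m.+1))))) z - b (L (toU (pu (u (t m))))) z|
      <= c2 * delta * snorm b z.
  move=> mn; have I1 := It m (leqW mn); have I2 := It m.+1 mn.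
  have := projected_first_difference hOm hTh hMv Du0 DuL2 LuL2 hpu hpv hLuh hv3 huD gvL2
    pdev Bv cru hgv Bgv I1 I2 (tS m) tau0 (Vval z).
  rewrite !bL// => hh.
  apply: (@le_trans _ _ (tau * ((tau * (`|B3| + `|Bg|) + 2 * (rr * h ^+ k)) * nrm Mv Om (val z)))).
    by rewrite ler_wpM2l// ltW.
  rewrite mulrA ler_wpM2r ?sqrtr_ge0// /c2 /delta.
  apply: le_trans (dominateT _ _ _ _ tauT rr0 hk0) _; apply: dominate => //.
  by apply: mulr_ge0 => //; apply: mulr_ge0 => //; exact: ltW.
have diff2 m z : (m < n)%N ->
    `|(b (L (toU (pu (u (t m.+2))))) z - b (L (toU (pu (u (t m.+1))))) z)
      - (b (L (toU (pu (u (t m.+1))))) z - b (L (toU (pu (u (t m))))) z)|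
      <= c3 * delta * snorm b z.
  move=> mn; have I1 := It m (leqW (ltnW mn)); have I2 := It m.+1 (leqW mn).
  have I3 := It m.+2 mn.
  have := projected_second_difference hOm hTh hMv Du0 DuL2 LuL2 hpu hpv hLuh hv3 huD gvL2
    pdev Bv cru hgv Bgv I1 I2 I3 (tS m) (tS m.+1) tau0 (Vval z).
  rewrite !bL// => /le_trans; apply.
  rewrite ler_wpM2r ?sqrtr_ge0//.
  have := dominate (2 * (`|B3| + `|Bg|)) (4 * rr) (tau ^+ 2) (h ^+ k).
  by rewrite -[4 * rr * _]mulrA; apply => //; apply: mulr_ge0 => //; exact: addr_ge0.
have conv : snorm a (toU (pu (u (t n.+1))) - toU (uh n.+1)) +
    snorm b (toV (pv (v (t n.+1))) - toV (vh n.+1)) <= C0 * delta.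
  have T0 : 0 <= T := ltW hT.
  have c10 : 0 <= c1 by rewrite addr_ge0.
  have c20 : 0 <= c2 by rewrite !addr_ge0// !mulr_ge0.
  have c30 : 0 <= c3 by rewrite addr_ge0// ?mulr_ge0// addr_ge0.
  have [cT0 cT1] := andP hcTheta.
  apply: (convergence ha hb adj Psa Pid (e := e') (lam := lam) (psi := fun i => Psi (lam i))
    (tau := tau) (cT := cTheta) (th := theta) (Cp := `|Cphi|) (N := n)
    (uh := fun m => toU (uh m)) (gu := fun m => toU (guh m)) (vh := fun m => toV (vh m))
    (vb := fun m => toV (vb m)) (gv := fun m => toV (gvh m))
    (uH := fun m => toU (pu (u (t m)))) (vH := fun m => toV (pv (v (t m))))
    eON' eE tau0 eig _ _ _ cT0 cT1 htheta (normr_ge0 _) cfl_lf scheme1 scheme2 scheme3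
    c10 c20 c30 delta0 hn) => //.
  - by move=> i; have [] := filt i.
  - by move=> i; have [] := filt i.
  - by move=> i; have [] := filt i.
have snorm_a x y : Vh Om Th k x -> Vh Om Th k y ->
    snorm a (toU x - toU y) = nrm Mu Om (x - y).
  by move=> Vx Vy; rewrite /snorm /a raddfB/= !toUE.
have snorm_b x y : Vh Om Th k x -> Vh Om Th k y ->
    snorm b (toV x - toV y) = nrm Mv Om (x - y).
  by move=> Vx Vy; rewrite /snorm /b raddfB/= !toVE.
have In := It n.+1 (leqnn _).
have VPu := Vpuu _ In; have VPv := Vpvv _ In.
have Vuh := uhV n.+1 (leqnn _); have Vvh := vhV n.+1 (leqnn _).
rewrite (snorm_a _ _ VPu Vuh) (snorm_b _ _ VPv Vvh) in conv.
have fin_u : nrm Mu Om (u (t n.+1) - uh n.+1) <=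
    `|Cpi| * Dm * `|B0| * delta + nrm Mu Om (pu (u (t n.+1)) - uh n.+1).
  have -> : u (t n.+1) - uh n.+1 = (u (t n.+1) - pu (u (t n.+1))) + (pu (u (t n.+1)) - uh n.+1).
    by rewrite addrA subrK.
  apply: le_trans (nrmD mOm hMu (L2B mOm (uL2 _ In) (Vh_L2 VPu)) (L2B mOm (Vh_L2 VPu) (Vh_L2 Vuh))) _.
  by apply: lerD => //; exact: Pu.
have fin_v : nrm Mv Om (v (t n.+1) - vh n.+1) <=
    `|Cpi| * Dm * `|B0| * delta + nrm Mv Om (pv (v (t n.+1)) - vh n.+1).
  have -> : v (t n.+1) - vh n.+1 = (v (t n.+1) - pv (v (t n.+1))) + (pv (v (t n.+1)) - vh n.+1).
    by rewrite addrA subrK.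
  apply: le_trans (nrmD mOm hMv (L2B mOm (vL2 _ In) (Vh_L2 VPv)) (L2B mOm (Vh_L2 VPv) (Vh_L2 Vvh))) _.
  by apply: lerD => //; exact: Pv.
apply: le_trans (nrm2_le _ _ _ _ _) _; apply: le_trans (lerD fin_u fin_v) _.
rewrite addrACA [leRHS]mulrDl -/h -/delta; apply: lerD => //.
by rewrite -!mulrA mulr_natl mulr2n.
Qed.
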